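(* For instances of the shared processor scheduling problem with any number $m\ge 1$ of shared processors, there exists a strongly polynomial time approximation algorithm with approximation ratio $\alpha=\frac{1}{2}+\frac{1}{4(m+1)}$; that is, the algorithm outputs a feasible schedule $\mathcal{S}$ with $\Sigma(\mathcal{S})\ge\alpha\,\Sigma(\mathcal{S}_{\mathrm{opt}})$, where $\mathcal{S}_{\mathrm{opt}}$ is an optimal schedule.
   Context: An instance consists of $n$ jobs, each job $j$ having a processing time $p_j\ge 0$ and a weight $w_j\ge 0$, and $m\ge 1$ shared processors $\mathcal{M}_1,\dots,\mathcal{M}_m$ with costs $c_1\le\cdots\le c_m$; each job $j$ has a private processor $\mathcal{P}_j$ usable only by $j$. A schedule selects for each job $j$ a finite collection of pairwise disjoint open intervals (pieces) on each shared processor and a single interval $(0,C_j)$ on $\mathcal{P}_j$. It is feasible if for each $j$, $C_j$ plus the total length of pieces of $j$ equals $p_j$; pieces of different jobs on the same shared processor are disjoint (pieces of the same job on different shared processors may overlap); and every piece of $j$ is contained in $(0,C_j)$. The total weighted overlap is $\Sigma(\mathcal{S})=\sum_{i=1}^m\sum_j o(j,\mathcal{M}_i)(w_j-c_i)$, where $o(j,\mathcal{M}_i)$ is the total length of time during which $j$ executes simultaneously on $\mathcal{P}_j$ and $\mathcal{M}_i$. An optimal schedule is a feasible schedule maximizing $\Sigma$. *)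

(* Defs.v *)
From mathcomp Require Import all_boot all_order all_algebra.
From mathcomp Require Import classical_sets set_interval reals.

Set Implicit Arguments.
Unset Strict Implicit.
Unset Printing Implicit Defensive.

Import Order.TTheory GRing.Theory Num.Theory.
Local Open Scope ring_scope.

(** * Instances and schedules *)

Record instance (F : realFieldType) (n m : nat) := Instance {
  ptime  : 'I_n -> F;
  weight : 'I_n -> F;
  cost   : 'I_m -> F;
  ptime_ge0  : forall j, 0 <= ptime j;
  weight_ge0 : forall j, 0 <= weight j;
  cost_le    : forall i k : 'I_m, (i <= k)%N -> cost i <= cost k;
  shared_gt0 : (0 < m)%N
}.

(* A pair (a, b) in [pieces S j i] stands for the open interval ]a, b[ during
   which job j runs on the i-th shared processor; [completion S j] is the C_j of the
   interval ]0, C_j[ on the private processor of j. *)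
Record schedule (F : realFieldType) (n m : nat) := Schedule {
  pieces : 'I_n -> 'I_m -> seq (F * F);
  completion  : 'I_n -> F
}.

Section Schedules.
Local Open Scope classical_set_scope.
Variables (R : realType) (n m : nat).
Implicit Types (I : instance R n m) (S : schedule R n m) (q : R * R).

Definition piece_set q : set R := `]q.1, q.2[.
Definition piece_len q : R := q.2 - q.1.

Definition well_formed S : Prop :=
  [/\ forall j, 0 <= completion S j,
      forall j i q, q \in pieces S j i -> q.1 < q.2 &
      forall j i (k l : nat), (k < l < size (pieces S j i))%N ->
        piece_set (nth (0, 0) (pieces S j i) k)
          `&` piece_set (nth (0, 0) (pieces S j i) l) = set0].

Definition feasible I S : Prop :=
  [/\ well_formed S,
      forall j, completion S j + \sum_(i < m) \sum_(q <- pieces S j i) piece_len q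
                = ptime I j,
      forall i j j' q q', j != j' ->
        q \in pieces S j i -> q' \in pieces S j' i ->
        piece_set q `&` piece_set q' = set0 &
      forall j i q, q \in pieces S j i ->
        piece_set q `<=` `]0, completion S j[].

(* Total length of the intersections of the (pairwise disjoint) pieces of j on
   the i-th shared processor with ]0, C_j[. *)
Definition overlap S (j : 'I_n) (i : 'I_m) : R :=
  \sum_(q <- pieces S j i)
    Num.max 0 (Num.min q.2 (completion S j) - Num.max q.1 0).

Definition total_overlap I S : R :=
  \sum_(i < m) \sum_(j < n) overlap S j i * (weight I j - cost I i).

Definition optimal I S : Prop :=
  feasible I S /\
  forall S', feasible I S' -> total_overlap I S' <= total_overlap I S.

End Schedules.

(** * Machine model

   Algorithms are programs of a random access machine with two kinds of
   registers: index registers holding natural numbers and data registers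
   holding elements of an ordered field.  Both are organised in doubly indexed
   arrays.  A program is a fixed finite text, mentions no field (the only data
   literals are natural numbers) and is therefore uniform in the field and in
   the numbers of jobs and processors.  Data can be added, subtracted,
   multiplied, divided and compared; there is no rounding.  Indices have
   no multiplication, so that index values have a number of bits at most
   linear in the running time and the input sizes. *)

Inductive iexp :=
| ILit of nat
| IGet of nat & iexp & iexp
| IAdd of iexp & iexp
| ISub of iexp & iexp.

Inductive dexp :=
| DLit of nat
| DGet of nat & iexp & iexp
| DAdd of dexp & dexp
| DSub of dexp & dexp
| DMul of dexp & dexp
| DDiv of dexp & dexp.

Inductive bexp :=
| BLtI of iexp & iexp
| BLtD of dexp & dexp
| BNot of bexp
| BAnd of bexp & bexp.

Inductive cmd :=
| Skip
| SetI of nat & iexp & iexp & iexp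
| SetD of nat & iexp & iexp & dexp
| Seq of cmd & cmd
| If of bexp & cmd & cmd
| While of bexp & cmd.

Record store (F : Type) := Store {
  ireg : nat -> nat -> nat -> nat;
  dreg : nat -> nat -> nat -> F
}.

Definition upd (T : Type) (r : nat -> nat -> nat -> T) (a i j : nat) (v : T) :=
  fun a' i' j' => if [&& a' == a, i' == i & j' == j] then v else r a' i' j'.

Fixpoint icost (e : iexp) : nat :=
  match e with
  | ILit _ => 1
  | IGet _ i j => (icost i + icost j).+1
  | IAdd e1 e2 | ISub e1 e2 => (icost e1 + icost e2).+1
  end.

Fixpoint dcost (e : dexp) : nat :=
  match e with
  | DLit _ => 1
  | DGet _ i j => (icost i + icost j).+1
  | DAdd e1 e2 | DSub e1 e2 | DMul e1 e2 | DDiv e1 e2 =>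
      (dcost e1 + dcost e2).+1
  end.

Fixpoint bcost (e : bexp) : nat :=
  match e with
  | BLtI e1 e2 => (icost e1 + icost e2).+1
  | BLtD e1 e2 => (dcost e1 + dcost e2).+1
  | BNot e1 => (bcost e1).+1
  | BAnd e1 e2 => (bcost e1 + bcost e2).+1
  end.

Section Semantics.
Variable F : realFieldType.
Implicit Type s : store F.

Fixpoint ieval s (e : iexp) : nat :=
  match e with
  | ILit k => k
  | IGet a i j => ireg s a (ieval s i) (ieval s j)
  | IAdd e1 e2 => (ieval s e1 + ieval s e2)%N
  | ISub e1 e2 => (ieval s e1 - ieval s e2)%N
  end.

Fixpoint deval s (e : dexp) : F :=
  match e with
  | DLit k => k%:R
  | DGet a i j => dreg s a (ieval s i) (ieval s j)
  | DAdd e1 e2 => deval s e1 + deval s e2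
  | DSub e1 e2 => deval s e1 - deval s e2
  | DMul e1 e2 => deval s e1 * deval s e2
  | DDiv e1 e2 => deval s e1 / deval s e2
  end.

Fixpoint beval s (e : bexp) : bool :=
  match e with
  | BLtI e1 e2 => (ieval s e1 < ieval s e2)%N
  | BLtD e1 e2 => deval s e1 < deval s e2
  | BNot e1 => ~~ beval s e1
  | BAnd e1 e2 => beval s e1 && beval s e2
  end.

(* [exec sz c s t b s']: started in [s], the command [c] halts in [s'] after
   [t] elementary operations, and [b] is the maximum of [sz v] over the values
   [v] written to data registers during the run.  Since expressions have
   bounded depth for a given program, the sizes of the values of
   subexpressions are controlled by those of the register contents. *)
Inductive exec (sz : F -> nat) :
    cmd -> store F -> nat -> nat -> store F -> Prop :=
| ExecSkip s : exec sz Skip s 1 0 s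
| ExecSetI s a i j e :
    exec sz (SetI a i j e) s (icost i + icost j + icost e).+1 0
      (Store (upd (ireg s) a (ieval s i) (ieval s j) (ieval s e)) (dreg s))
| ExecSetD s a i j e :
    exec sz (SetD a i j e) s (icost i + icost j + dcost e).+1
      (sz (deval s e))
      (Store (ireg s) (upd (dreg s) a (ieval s i) (ieval s j) (deval s e)))
| ExecSeq c1 c2 s s1 s2 t1 t2 b1 b2 :
    exec sz c1 s t1 b1 s1 -> exec sz c2 s1 t2 b2 s2 ->
    exec sz (Seq c1 c2) s (t1 + t2) (maxn b1 b2) s2
| ExecIf e c1 c2 s s' t b :
    exec sz (if beval s e then c1 else c2) s t b s' ->
    exec sz (If e c1 c2) s (bcost e + t) b s'
| ExecWhileFalse e c s :
    ~~ beval s e -> exec sz (While e c) s (bcost e) 0 s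
| ExecWhileTrue e c s s1 s2 t1 t2 b1 b2 :
    beval s e -> exec sz c s t1 b1 s1 -> exec sz (While e c) s1 t2 b2 s2 ->
    exec sz (While e c) s (bcost e + t1 + t2) (maxn b1 b2) s2.

(** Input and output conventions *)

Definition ext (n : nat) (f : 'I_n -> F) (k : nat) : F := oapp f 0 (insub k).

(* Index registers: n at 0[0,0] and m at 0[1,0].  Data registers: p_j at
   0[j,0], w_j at 1[j,0], c_i at 2[i,0].  All other registers are 0. *)
Definition input (n m : nat) (I : instance F n m) : store F :=
  Store
    (fun a i j => match a, i, j with
                  | 0, 0, 0 => n
                  | 0, 1, 0 => m
                  | _, _, _ => 0
                  end%N)
    (fun a i j => match a, j with
                  | 0%N, 0%N => ext (ptime I) i
                  | 1%N, 0%N => ext (weight I) i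
                  | 2%N, 0%N => ext (cost I) i
                  | _, _ => 0
                  end).

(* Index register 1[0,0] holds the number N of pieces.  For k < N the k-th
   piece belongs to the job with number 2[k,0] and runs on the shared processor
   with number 2[k,1] (index registers), during ]3[k,0], 3[k,1][ (data
   registers).  Data register 4[j,0] holds C_j. *)
Definition output (n m : nat) (s : store F) : schedule F n m :=
  Schedule
    (fun j i => [seq (dreg s 3 k 0, dreg s 3 k 1)
                | k <- iota 0 (ireg s 1 0 0)
                & (ireg s 2 k 0 == j) && (ireg s 2 k 1 == i)])
    (fun j => dreg s 4 j 0).

End Semantics.

(** * Strongly polynomial time *)

(* A function is polynomially bounded iff it is bounded by [poly_bound k] for
   some k. *)
Definition poly_bound (k N : nat) : nat := (k * N.+1 ^ k)%N.

Definition nat_bits (k : nat) : nat := (trunc_log 2 k).+1.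

(* One bit for the sign. *)
Definition rat_bits (q : rat) : nat :=
  (nat_bits `|numq q| + nat_bits `|denq q|).+1.

Definition encoding_length (n m : nat) (I : instance rat n m) : nat :=
  (\sum_(j < n) (rat_bits (ptime I j) + rat_bits (weight I j))
   + \sum_(i < m) rat_bits (cost I i))%N.

(* The number of elementary operations is polynomial in the number n + m of
   jobs and processors, whatever the numerical data are, and for rational data
   the numbers computed have a bit length polynomial in that of the input. *)
Definition strongly_polynomial (prog : cmd) : Prop :=
  (exists k : nat, forall (F : realFieldType) (n m : nat)
     (I : instance F n m), exists t b s,
     exec (fun=> 0%N) prog (input I) t b s /\ (t <= poly_bound k (n + m))%N)
  /\
  (exists k : nat, forall (n m : nat) (I : instance rat n m), exists t b s,
     exec rat_bits prog (input I) t b s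
     /\ (b <= poly_bound k (encoding_length I))%N).

Definition returns (F : realFieldType) (n m : nat) (prog : cmd)
    (I : instance F n m) (S : schedule F n m) : Prop :=
  exists t b s, exec (fun=> 0%N) prog (input I) t b s /\ output n m s = S.

Definition approximation_algorithm (alpha : forall R : realType, nat -> R)
    (prog : cmd) : Prop :=
  forall (R : realType) (n m : nat) (I : instance R n m),
    exists S : schedule R n m,
      [/\ returns prog I S,
          feasible I S &
          forall Sopt, optimal I Sopt ->
            alpha R m * total_overlap I Sopt <= total_overlap I S].

(* Main.v *)
Require Import Defs.
From mathcomp Require Import all_boot all_order all_algebra reals.
From mathcomp Require Import boolp classical_sets set_interval.
From mathcomp Require Import zify ring lra.

(** Let beta = (m + 1) / (2m + 1), which is at least the required ratio. In a feasible
    schedule each processor carries at most p_l units of jobs j with p_j <= p_l, and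
    p_j <= (m + 1) C_j. Multiplying the lengths of all pieces by beta therefore gives a
    solution of the linear program in which job j must leave the shared processors
    before beta p_j and uses them for at most (1 - beta) p_j in total; conversely a
    solution of this program, laid out by increasing deadline, is a schedule.

    The program is solved exactly by a greedy algorithm. The k cheapest processors are
    kept as a pool in which only the prefix sums of the amounts y_j matter, bounded by k
    times the deadline. From the most expensive processor k of the pool down, one first
    admits the jobs with w_j > c_k by decreasing weight, each with the largest feasible
    amount, and then separates processor k from the pool, giving it the least amounts
    that the other k - 1 cannot carry. If a threshold theta sweeps downwards over the
    weights and costs in this order, the value gained by the algorithm below theta
    grows at the rate sum_j y_j, which is the maximum flow from the admitted jobs to
    the pool, whereas that of any other solution grows at most at this rate.

    The numbers computed are sums and differences of inputs, except for one final
    quotient, so that they stay in a fixed lattice (1/D)Z and the number of their bits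
    is bounded by the running time. *)

Set Implicit Arguments.
Unset Strict Implicit.
Unset Printing Implicit Defensive.

Import Order.TTheory GRing.Theory Num.Theory.
Local Open Scope ring_scope.

(** * Programs with bounded loops *)

(* [PFor a r p] runs [p] with the counter in index register a[0,0], which counts
   up to the content of 0[r,0], that is to n for r = 0 and to m for r = 1. *)
Inductive prog :=
| PSetI of nat & iexp & iexp & iexp
| PSetD of nat & iexp & iexp & dexp
| PSeq of prog & prog
| PWhen of bexp & prog
| PFor of nat & nat & prog.

Fixpoint compile (p : prog) : cmd :=
  match p with
  | PSetI a i j e => SetI a i j e
  | PSetD a i j e => SetD a i j e
  | PSeq p1 p2 => Seq (compile p1) (compile p2)
  | PWhen b p => If b (compile p) Skip
  | PFor a r p => Seq (SetI a (ILit 0) (ILit 0) (ILit 0))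
      (While (BLtI (IGet a (ILit 0) (ILit 0)) (IGet 0 (ILit r) (ILit 0)))
        (Seq (compile p) (SetI a (ILit 0) (ILit 0)
                            (IAdd (IGet a (ILit 0) (ILit 0)) (ILit 1)))))
  end.

Fixpoint iwrites (p : prog) : seq nat :=
  match p with
  | PSetI a _ _ _ => [:: a]
  | PSetD _ _ _ _ => [::]
  | PSeq p1 p2 => iwrites p1 ++ iwrites p2
  | PWhen _ p => iwrites p
  | PFor a _ p => a :: iwrites p
  end.

Fixpoint dwrites (p : prog) : seq nat :=
  match p with
  | PSetI _ _ _ _ => [::]
  | PSetD a _ _ _ => [:: a]
  | PSeq p1 p2 => dwrites p1 ++ dwrites p2
  | PWhen _ p | PFor _ _ p => dwrites p
  end.

Definition out_array : pred nat := [pred a | (a == 3) || (a == 4)].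

(** The literals 0 and 1 are the only constants for which [ok] is assumed; each addition or
    subtraction raises its bound by one. *)
Fixpoint additive (e : dexp) : bool :=
  match e with
  | DLit k => (k <= 1)%N
  | DGet a _ _ => ~~ out_array a
  | DAdd e1 e2 | DSub e1 e2 => additive e1 && additive e2
  | _ => false
  end.

(* Quotients may only be stored in the output arrays, which are never read;
   this keeps all other registers in a fixed lattice of rationals. *)
Definition storable (a : nat) (e : dexp) : bool :=
  additive e ||
  (out_array a && if e is DDiv e1 e2 then additive e1 && additive e2 else false).

(** Index array 0 holds n and m, the bounds of all loops. Protecting it, and each counter from the
    body of its loop, fixes the number of rounds on entry. *)
Fixpoint wf (p : prog) : bool :=
  match p with
  | PSetI a _ _ _ => a != 0%N
  | PSetD a _ _ e => storable a e
  | PSeq p1 p2 => wf p1 && wf p2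
  | PWhen _ p => wf p
  | PFor a _ p => [&& a != 0%N, a \notin iwrites p & wf p]
  end.

Lemma wf_iwrites0 p : wf p -> 0%N \notin iwrites p.
Proof.
elim: p => [a i j e|a i j e|p1 IH1 p2 IH2|b p IH|a r p IH] //=.
- by rewrite inE eq_sym.
- by case/andP=> /IH1 h1 /IH2 h2; rewrite mem_cat negb_or h1.
- by case/and3P=> h _ /IH h2; rewrite inE negb_or eq_sym h.
Qed.

(** For a loop, 11 pays for the initialisation of the counter (4) and the last test (7), and 15 for
    the test (7) and the increment (8) of each round. *)
Fixpoint tbound (p : prog) (N : nat) : nat :=
  match p with
  | PSetI _ i j e => (icost i + icost j + icost e).+1
  | PSetD _ i j e => (icost i + icost j + dcost e).+1
  | PSeq p1 p2 => tbound p1 N + tbound p2 N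
  | PWhen b p => bcost b + (1 + tbound p N)
  | PFor _ _ p => 11 + N * (15 + tbound p N)
  end.

Lemma poly_bound_add k1 k2 N :
  (poly_bound k1 N + poly_bound k2 N <= poly_bound (k1 + k2) N)%N.
Proof.
rewrite /poly_bound mulnDl leq_add // leq_mul2l leq_pexp2l ?orbT //.
  exact: leq_addr.
exact: leq_addl.
Qed.

Lemma poly_bound_const c N : (c <= poly_bound c N)%N.
Proof. by rewrite leq_pmulr // expn_gt0. Qed.

Lemma poly_bound_mul k N : (N * poly_bound k N <= poly_bound k.+1 N)%N.
Proof.
rewrite /poly_bound mulnCA leq_mul // expnS leq_mul //; lia.
Qed.

(** A loop multiplies the bound by N, which raises the parameter of [poly_bound] by one; the program
    text alone determines the final parameter. *)
Lemma tbound_poly p : exists k, forall N, (tbound p N <= poly_bound k N)%N.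
Proof.
elim: p => [a i j e|a i j e|p1 [k1 H1] p2 [k2 H2]|b p [k H]|a r p [k H]] /=.
- by eexists => N; exact: poly_bound_const.
- by eexists => N; exact: poly_bound_const.
- exists (k1 + k2)%N => N; apply: leq_trans (poly_bound_add _ _ _).
  exact: leq_add.
- exists (bcost b + (1 + k))%N => N; apply: leq_trans (poly_bound_add _ _ _).
  apply: leq_add; first exact: poly_bound_const.
  apply: leq_trans (poly_bound_add _ _ _); apply: leq_add (H N).
  exact: (poly_bound_const 1).
- exists (11 + (15 + k).+1)%N => N; apply: leq_trans (poly_bound_add _ _ _).
  apply: leq_add; first exact: poly_bound_const.
  apply: leq_trans (poly_bound_mul _ _); rewrite leq_mul2l; apply/orP; right.
  apply: leq_trans (poly_bound_add _ _ _).
  by apply: leq_add => //; exact: poly_bound_const.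
Qed.

(** * Denotational semantics and resource bounds *)

Section Denotation.
Variable F : realFieldType.
Implicit Type s : store F.

Definition seti s a i j v := Store (upd (ireg s) a i j v) (dreg s).
Definition setd s a i j v := Store (ireg s) (upd (dreg s) a i j v).

(** The bound of a loop is read once on entry and the counter is assigned rather than incremented;
    under [wf] this agrees with the compiled while loop. *)
Fixpoint den (p : prog) s : store F :=
  match p with
  | PSetI a i j e => seti s a (ieval s i) (ieval s j) (ieval s e)
  | PSetD a i j e => setd s a (ieval s i) (ieval s j) (deval s e)
  | PSeq p1 p2 => den p2 (den p1 s)
  | PWhen b p => if beval s b then den p s else s
  | PFor a r p => iteri (ireg s 0 r 0)
      (fun k s' => seti (den p s') a 0 0 k.+1) (seti s a 0 0 0)
  end.

Definition agree (iw dw : seq nat) s s' :=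
  (forall a i j, a \notin iw -> ireg s' a i j = ireg s a i j) /\
  (forall a i j, a \notin dw -> dreg s' a i j = dreg s a i j).

Lemma agree_trans iw dw s1 s2 s3 :
  agree iw dw s1 s2 -> agree iw dw s2 s3 -> agree iw dw s1 s3.
Proof.
move=> [i1 d1] [i2 d2]; split=> a i j h; first by rewrite i2 // i1.
by rewrite d2 // d1.
Qed.

Lemma agree_sub iw dw iw' dw' s s' :
  {subset iw <= iw'} -> {subset dw <= dw'} ->
  agree iw dw s s' -> agree iw' dw' s s'.
Proof.
move=> si sd [hi hd]; split=> a i j h; first by apply: hi; apply: contra h => /si.
by apply: hd; apply: contra h => /sd.
Qed.

Lemma agree_seti s a i j v iw dw : a \in iw -> agree iw dw s (seti s a i j v).
Proof.
move=> h; split=> // a' i' j' h'; rewrite /= /upd.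
by case: eqP => //= e; rewrite e h in h'.
Qed.

Lemma agree_setd s a i j v iw dw : a \in dw -> agree iw dw s (setd s a i j v).
Proof.
move=> h; split=> // a' i' j' h'; rewrite /= /upd.
by case: eqP => //= e; rewrite e h in h'.
Qed.

Lemma frame p s : agree (iwrites p) (dwrites p) s (den p s).
Proof.
elim: p s => [a i j e|a i j e|p1 IH1 p2 IH2|b p IH|a r p IH] s /=.
- by apply: agree_seti; rewrite inE.
- by apply: agree_setd; rewrite inE.
- apply: agree_trans (agree_sub _ _ (IH1 s)) (agree_sub _ _ (IH2 _)) => x;
  by rewrite mem_cat => ->; rewrite ?orbT.
- by case: ifP => _ //; exact: IH.
- elim: (ireg s 0 r 0) => [|k IHk] /=; first by apply: agree_seti; rewrite inE eqxx.
  apply: agree_trans IHk _; apply: (@agree_trans _ _ _ (den p (iteri k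
     (fun k s' => seti (den p s') a 0 0 k.+1) (seti s a 0 0 0)))).
    by apply: agree_sub (IH _) => // x h; rewrite inE h orbT.
  by apply: agree_seti; rewrite inE eqxx.
Qed.

(** In the step, the counter and all arrays that the loop does not write are known, so an invariant
    need only describe what changes. *)
Lemma for_ind (Inv : nat -> store F -> Prop) a r p s :
  Inv 0%N (seti s a 0 0 0) ->
  (forall k s', (k < ireg s 0 r 0)%N -> ireg s' a 0 0 = k ->
     agree (a :: iwrites p) (dwrites p) s s' -> Inv k s' ->
     Inv k.+1 (seti (den p s') a 0 0 k.+1)) ->
  Inv (ireg s 0 r 0) (den (PFor a r p) s).
Proof.
move=> h0 hS /=; set N := ireg s 0 r 0 in hS *.
suff: forall k, (k <= N)%N -> let s' := iteri k
     (fun k s' => seti (den p s') a 0 0 k.+1) (seti s a 0 0 0) in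
   [/\ ireg s' a 0 0 = k, agree (a :: iwrites p) (dwrites p) s s' & Inv k s'].
  by move=> /(_ N (leqnn N)) [].
elim=> [|k IH] kN /=.
  split=> //; first by rewrite /upd !eqxx.
  by apply: agree_seti; rewrite inE eqxx.
have [c1 a1 i1] := IH (ltnW kN); split.
- by rewrite /upd !eqxx.
- apply: (agree_trans a1); apply: (agree_trans (s2 := den p (iteri k
     (fun k s' => seti (den p s') a 0 0 k.+1) (seti s a 0 0 0)))).
    by apply: agree_sub (frame _ _) => // x h; rewrite inE h orbT.
  by apply: agree_seti; rewrite inE eqxx.
- exact: hS.
Qed.

(* [ok K v] says that the magnitude of [v] is controlled by [K]; for rationals it will
   say that [v] has a fixed denominator and a numerator of at most [K] bits. *)
Variables (sz : F -> nat) (ok : nat -> F -> Prop) (K0 : nat).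
Hypothesis ok_le : forall K K' v, (K <= K')%N -> ok K v -> ok K' v.
Hypothesis ok0 : ok K0 0.
Hypothesis ok1 : ok K0 1.
Hypothesis okD : forall K x y, ok K x -> ok K y -> ok K.+1 (x + y).
Hypothesis okB : forall K x y, ok K x -> ok K y -> ok K.+1 (x - y).
Hypothesis ok_sz : forall K x, (K0 <= K)%N -> ok K x -> (sz x <= K.*2 + 3)%N.
Hypothesis ok_szV :
  forall K x y, (K0 <= K)%N -> ok K x -> ok K y -> (sz (x / y) <= K.*2 + 3)%N.

Definition okst (K : nat) s :=
  (K0 <= K)%N /\ forall a i j, ~~ out_array a -> ok K (dreg s a i j).

Lemma okst_le K K' s : (K <= K')%N -> okst K s -> okst K' s.
Proof.
move=> h [h0 hs]; split; first exact: leq_trans h.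
by move=> a i j /hs h1; apply: ok_le h (h1 _ _).
Qed.

Lemma deval_ok K s e : okst K s -> additive e -> ok (K + dcost e) (deval s e).
Proof.
move=> oks; elim: e => //= [k|a i j|e1 IH1 e2 IH2|e1 IH1 e2 IH2].
- case: k => [|[|//]] _; [move: ok0|move: ok1]; apply: ok_le;
  by apply: leq_trans (leq_addr _ _); case: oks.
- by move=> ha; apply: ok_le (leq_addr _ _) _; case: oks => _; apply.
- move=> /andP[/IH1 h1 /IH2 h2]; rewrite addnS; apply: okD.
    by apply: ok_le h1; lia.
  by apply: ok_le h2; lia.
- move=> /andP[/IH1 h1 /IH2 h2]; rewrite addnS; apply: okB.
    by apply: ok_le h1; lia.
  by apply: ok_le h2; lia.
Qed.

(** Evaluating an expression raises the bound K by at most its cost, so sizes are controlled by the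
    running time. *)
Lemma exec_den p N K s :
  wf p -> (forall r, (ireg s 0 r 0 <= N)%N) -> okst K s ->
  exists t b, [/\ exec sz (compile p) s t b (den p s), (t <= tbound p N)%N,
    (b <= (K + tbound p N).*2 + 3)%N & okst (K + tbound p N) (den p s)].
Proof.
elim: p K s => [a i j e|a i j e|p1 IH1 p2 IH2|b p IH|a r p IH] K s /=.
- move=> _ _ oks; do 2 eexists; split; first exact: ExecSetI.
  + by [].
  + by [].
  + by case: (okst_le (leq_addr (icost i + icost j + icost e).+1 K) oks).
- move=> he _ oks; do 2 eexists; split; first exact: ExecSetD.
  + by [].
  + move: he; rewrite /storable; set M := (icost i + icost j + _).+1.
    have [k0M oks'] := okst_le (leq_addr M K) oks.
    case/orP => [h|/andP[_]].
      apply: ok_sz => //; apply: ok_le (deval_ok oks h); rewrite /M; lia.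
    case: e @M k0M oks' => //= e1 e2 k0M oks' /andP[h1 h2].
    apply: ok_szV => //; [apply: ok_le (deval_ok oks h1)|apply: ok_le (deval_ok oks h2)]; lia.
  + set M := (icost i + icost j + _).+1.
    have [k0M oks'] := okst_le (leq_addr M K) oks.
    split=> // a' i' j' ha'; rewrite /= /upd; case: ifP => [/and3P[/eqP ea _ _]|_].
      move: he; rewrite /storable -ea (negbTE ha') orbF => h.
      by apply: ok_le (deval_ok oks h); rewrite /M; lia.
    exact: oks'.
- move=> /andP[w1 w2] hN oks.
  have [t1 [b1 [e1 ht1 hb1 ok1']]] := IH1 _ _ w1 hN oks.
  have hN' r : (ireg (den p1 s) 0 r 0 <= N)%N.
    by rewrite (frame p1 s).1 ?wf_iwrites0.
  have [t2 [b2 [e2 ht2 hb2 ok2']]] := IH2 _ _ w2 hN' ok1'.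
  exists (t1 + t2)%N, (maxn b1 b2); split; first exact: ExecSeq e1 e2.
  + exact: leq_add.
  + by rewrite geq_max; lia.
  + by rewrite addnA.
- move=> wp hN oks; case E: (beval s b).
    have [t [c [e1 ht hb ok']]] := IH _ _ wp hN oks.
    exists (bcost b + t)%N, c; split; [by apply: ExecIf; rewrite E|lia|lia|].
    by apply: okst_le ok'; lia.
  exists (bcost b + 1)%N, 0%N; split; [|lia|lia|by apply: okst_le oks; lia].
  by apply: ExecIf; rewrite E; exact: ExecSkip.
- move=> /and3P[a0 ap wp] hN oks.
  set NN := ireg s 0 r 0; pose st k := iteri k
     (fun k s' => seti (den p s') a 0 0 k.+1) (seti s a 0 0 0).
  have p0 := wf_iwrites0 wp.
  have st0 k r' : ireg (st k) 0 r' 0 = ireg s 0 r' 0.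
    elim: k => [|k IHk] /=; first by rewrite /upd eq_sym (negbTE a0).
    by rewrite /upd eq_sym (negbTE a0) /= (frame p _).1.
  have stN k r' : (ireg (st k) 0 r' 0 <= N)%N by rewrite st0.
  have sta k : ireg (st k) a 0 0 = k by case: k => [|k] /=; rewrite /upd !eqxx.
  pose X := (15 + tbound p N)%N.
  have okk k : (k <= NN)%N -> okst (K + k * X) (st k).
    elim: k => [|k IHk] kN; first by rewrite /= addn0.
    have [t [b [_ _ _ h]]] := IH _ (st k) wp (stN k) (IHk (ltnW kN)).
    rewrite -[st k.+1]/(seti (den p (st k)) a 0 0 k.+1).
    have : okst (K + k.+1 * X) (den p (st k)) by apply: okst_le h; rewrite /X; lia.
    by [].
  (* The induction is on the number k of rounds that remain. *)
  have loop k : (k <= NN)%N -> exists t b,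
     [/\ exec sz (While (BLtI (IGet a (ILit 0) (ILit 0)) (IGet 0 (ILit r) (ILit 0)))
        (Seq (compile p) (SetI a (ILit 0) (ILit 0)
            (IAdd (IGet a (ILit 0) (ILit 0)) (ILit 1))))) (st (NN - k)%N) t b (st NN),
        (t <= 7 + k * X)%N & (b <= (K + NN * X).*2 + 3)%N].
    elim: k => [|k IHk] kN.
      rewrite subn0; exists 7%N, 0%N; split => //.
      by apply: ExecWhileFalse; rewrite /= sta st0 ltnn.
    have [t [b [h ht hb]]] := IHk (ltnW kN).
    set u := (NN - k.+1)%N; have uN : (u < NN)%N by rewrite /u; lia.
    have [t1 [b1 [h1 ht1 hb1 _]]] := IH _ (st u) wp (stN u) (okk _ (ltnW uN)).
    have hu : (NN - k = u.+1)%N by rewrite /u; lia.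
    rewrite hu in h.
    exists (7 + (t1 + 8) + t)%N, (maxn (maxn b1 0) b); split.
    + apply: (ExecWhileTrue (s1 := st u.+1)); [by rewrite /= sta st0 | | exact: h].
      apply: (ExecSeq (s1 := den p (st u))) => //.
      have <- : seti (den p (st u)) a 0 0 (ireg (den p (st u)) a 0 0 + 1)%N = st u.+1.
        by rewrite (frame p _).1 // sta addn1.
      exact: (ExecSetI _ _ a (ILit 0) (ILit 0) (IAdd (IGet a (ILit 0) (ILit 0)) (ILit 1))).
    + rewrite /X; lia.
    + rewrite !geq_max hb andbT /=; rewrite (leq_trans hb1) //.
      have : (u.+1 * X <= NN * X)%N by rewrite leq_mul.
      rewrite mulSn {1}/X; lia.
  have [t [b [h ht hb]]] := loop _ (leqnn NN).
  have hXN : (NN * X <= N * X)%N by rewrite leq_mul // hN.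
  rewrite subnn in h; exists (4 + t)%N, (maxn 0 b); split.
  + apply: (ExecSeq (s1 := st 0%N)) => //.
    exact: (ExecSetI _ s a (ILit 0) (ILit 0) (ILit 0)).
  + by move: ht hXN; rewrite /X; lia.
  + by rewrite max0n; move: hb hXN; rewrite /X; lia.
  + by apply: okst_le (okk _ (leqnn _)); move: hXN; rewrite /X; lia.
Qed.

End Denotation.

(** * Bit lengths of rationals with a common denominator *)

Lemma leq_nat_bits k l : (k <= l)%N -> (nat_bits k <= nat_bits l)%N.
Proof. by move=> kl; rewrite ltnS leq_trunc_log. Qed.

Lemma nat_bits_exp k K : (k <= 2 ^ K)%N -> (nat_bits k <= K.+1)%N.
Proof. by move/leq_nat_bits; rewrite /nat_bits trunc_expnK. Qed.

Lemma ltn_exp_nat_bits k : (k < 2 ^ nat_bits k)%N.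
Proof. exact: trunc_log_ltn. Qed.

(** Reduction to lowest terms only shrinks: for nonzero a and b, cross-multiplication and
    coprimality make the reduced numerator and denominator divisors of a and b. *)
Lemma rat_bits_quotient (a b : int) :
  (rat_bits (a%:~R / b%:~R) <= nat_bits `|a| + nat_bits `|b| + 1)%N.
Proof.
rewrite /rat_bits -addn1 leq_add2r; set v : rat := _ / _.
have [a0|a0] := eqVneq a 0.
  by rewrite /v a0 mulr0z mul0r; case: `|b|%N => [|b'] //; apply: leq_add.
have [b0|b0] := eqVneq b 0.
  by rewrite /v b0 mulr0z invr0 mulr0; case: `|a|%N => [|a'] //; apply: leq_add.
have bQ : b%:~R != 0 :> rat by rewrite intr_eq0.
have E : numq v * b = a * denq v.
  apply: (@intr_inj rat); rewrite !intrM numqE /v.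
  by rewrite mulrAC mulfVK.
have cop : coprimez (numq v) (denq v).
  by rewrite coprimezE coprime_num_den.
have h1 : (`|numq v| %| `|a|)%N.
  rewrite -dvdzE -(Gauss_dvdzl _ cop) -E; exact: dvdz_mulr.
have h2 : (`|denq v| %| `|b|)%N.
  have cop' : coprimez (denq v) (numq v) by rewrite coprimez_sym.
  rewrite -dvdzE -(Gauss_dvdzr _ cop') E; exact: dvdz_mull.
by apply: leq_add; apply: leq_nat_bits; apply: dvdn_leq => //; rewrite absz_gt0.
Qed.

Definition lattice_ok (D : int) (K : nat) (v : rat) : Prop :=
  exists2 z : int, v * D%:~R = z%:~R & (`|z| <= 2 ^ K)%N.

Definition common_denom (s : seq rat) : int := \prod_(q <- s) denq q.

Lemma common_denom_gt0 s : 0 < common_denom s.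
Proof. by apply: prodr_gt0 => q _; exact: denq_gt0. Qed.

Lemma common_denom_bits s :
  (`|common_denom s| <= 2 ^ (\sum_(q <- s) rat_bits q))%N.
Proof.
rewrite /common_denom; elim: s => [|q s IH]; first by rewrite !big_nil.
rewrite !big_cons abszM expnD leq_mul //.
apply: leq_trans (ltnW (ltn_exp_nat_bits _)) _; rewrite leq_exp2l //.
by rewrite /rat_bits; lia.
Qed.

(** Over the common denominator the numerator is [numq q] times the cofactor of [denq q]; each
    factor uses one copy of the total bit length. *)
Lemma common_denom_ok s q : q \in s ->
  lattice_ok (common_denom s) (\sum_(q <- s) rat_bits q).*2 q.
Proof.
move=> qs; have /dvdzP[k Ek] : (denq q %| common_denom s)%Z.
  rewrite /common_denom (perm_big _ (perm_to_rem qs)) big_cons; exact: dvdz_mulr.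
exists (numq q * k).
  by rewrite Ek !intrM mulrCA mulrC -numqE.
have qb : (rat_bits q <= \sum_(q <- s) rat_bits q)%N.
  by rewrite (perm_big _ (perm_to_rem qs)) big_cons leq_addr.
rewrite abszM -addnn expnD leq_mul //.
  apply: leq_trans (ltnW (ltn_exp_nat_bits _)) _; rewrite leq_exp2l //.
  apply: leq_trans qb; by rewrite /rat_bits; lia.
apply: leq_trans (common_denom_bits s).
rewrite Ek abszM; apply: leq_pmulr; rewrite absz_gt0 denq_eq0 //.
Qed.

Section Lattice.
Variables (D : int) (K0 : nat).
Lemma lattice_ok_le K K' v : (K <= K')%N -> lattice_ok D K v -> lattice_ok D K' v.
Proof.
move=> h [z e hz]; exists z => //; apply: leq_trans hz _.
by rewrite leq_exp2l.
Qed.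

Lemma lattice_ok0 : lattice_ok D K0 0.
Proof. by exists 0; rewrite ?mul0r. Qed.

Lemma lattice_okD K x y :
  lattice_ok D K x -> lattice_ok D K y -> lattice_ok D K.+1 (x + y).
Proof.
move=> [z1 e1 h1] [z2 e2 h2]; exists (z1 + z2); first by rewrite mulrDl e1 e2 intrD.
by rewrite expnS; lia.
Qed.

Lemma lattice_okB K x y :
  lattice_ok D K x -> lattice_ok D K y -> lattice_ok D K.+1 (x - y).
Proof.
move=> [z1 e1 h1] [z2 e2 h2]; exists (z1 - z2); first by rewrite mulrBl e1 e2 intrB.
by rewrite expnS; lia.
Qed.

Hypotheses (D0 : 0 < D) (DK : (`|D| <= 2 ^ K0)%N).

Let DQ : D%:~R != 0 :> rat. Proof. by rewrite intr_eq0 gt_eqF. Qed.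

Lemma lattice_ok1 : lattice_ok D K0 1.
Proof. by exists D; rewrite ?mul1r. Qed.

Lemma lattice_ok_bits K x :
  (K0 <= K)%N -> lattice_ok D K x -> (rat_bits x <= K.*2 + 3)%N.
Proof.
move=> hK [z e h]; have -> : x = z%:~R / D%:~R by rewrite -e mulfK.
apply: leq_trans (rat_bits_quotient _ _) _.
by move: (nat_bits_exp h) (nat_bits_exp DK); lia.
Qed.

(** The common denominator D cancels, leaving a quotient of two integers of at most [K.+1] bits. *)
Lemma lattice_ok_bitsV K x y : (K0 <= K)%N ->
  lattice_ok D K x -> lattice_ok D K y -> (rat_bits (x / y) <= K.*2 + 3)%N.
Proof.
move=> hK [z1 e1 h1] [z2 e2 h2]; have -> : x / y = z1%:~R / z2%:~R.
  by rewrite -e1 -e2 invfM mulrACA divff // mulr1.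
apply: leq_trans (rat_bits_quotient _ _) _.
by move: (nat_bits_exp h1) (nat_bits_exp h2); lia.
Qed.

End Lattice.

(** * Strong polynomiality of well-formed programs *)

Lemma input_bounds (F : realFieldType) n m (I : instance F n m) r :
  (ireg (input I) 0 r 0 <= n + m)%N.
Proof. by case: r => [|[|r]] //=; lia. Qed.

Lemma ext_cases (F : realFieldType) k (f : 'I_k -> F) i :
  ext f i = 0 \/ exists j, ext f i = f j.
Proof. by rewrite /ext; case: insub => [j|] /=; [right; exists j|left]. Qed.

Lemma exec_input (F : realFieldType) n m (I : instance F n m) p : wf p ->
  exists t b, exec (fun=> 0%N) (compile p) (input I) t b (den p (input I)) /\
              (t <= tbound p (n + m))%N.
Proof.
move=> wp; have [t [b [h ht _ _]]] :=
    @exec_den F (fun=> 0%N) (fun _ _ => True) 0 (fun _ _ _ _ _ => Logic.I)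
      Logic.I Logic.I (fun _ _ _ _ _ => Logic.I) (fun _ _ _ _ _ => Logic.I)
      (fun _ _ _ _ => isT) (fun _ _ _ _ _ _ => isT) p (n + m) 0 (input I) wp
      (input_bounds I) (conj isT (fun _ _ _ _ => Logic.I)).
by exists t, b.
Qed.

Lemma wf_strongly_polynomial p : wf p -> strongly_polynomial (compile p).
Proof.
move=> wp; have [k hk] := tbound_poly p; split.
  exists k => F n m I.
  have [t [b [h ht]]] := exec_input I wp.
  exists t, b, (den p (input I)); split=> //; exact: leq_trans (hk _).
(* The bound of [exec_den] is twice the sum of 2L and the time bound, plus 3: hence 4 for the input,
   k + k for the time, and 3. *)
exists (4 + (k + k) + 3)%N => n m I; set L := encoding_length I.
pose s := [seq ptime I j | j <- index_enum 'I_n] ++ [seq weight I j | j <- index_enum 'I_n]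
          ++ [seq cost I i | i <- index_enum 'I_m].
have sL : (\sum_(q <- s) rat_bits q)%N = L.
  by rewrite /s !big_cat !big_map /= /L /encoding_length big_split /= addnA.
(* Every input number has at least one bit, so a time bound in n + m is also one in L. *)
have nmL : (n + m <= L)%N.
  rewrite /L /encoding_length leq_add //.
    rewrite -{1}[n]card_ord -sum1_card; apply: leq_sum => j _; rewrite /rat_bits; lia.
  rewrite -{1}[m]card_ord -sum1_card; apply: leq_sum => j _; rewrite /rat_bits; lia.
have okL v : v \in s -> lattice_ok (common_denom s) L.*2 v.
  by move=> /common_denom_ok; rewrite sL.
have D0 := common_denom_gt0 s.
have DL : (`|common_denom s| <= 2 ^ L.*2)%N.
  apply: leq_trans (common_denom_bits s) _; rewrite sL leq_exp2l //; lia.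
have okI : okst (lattice_ok (common_denom s)) L.*2 L.*2 (input I).
  split=> // a i j _ /=.
  have ok0 := lattice_ok0 (common_denom s) L.*2.
  have mem_ext r (f : 'I_r -> rat) : {subset [seq f j | j <- index_enum 'I_r] <= s} ->
      lattice_ok (common_denom s) L.*2 (ext f i).
    move=> sub; have [->//|[j' ->]] := ext_cases f i.
    by apply: okL; apply: sub; apply: map_f; rewrite mem_index_enum.
  case: a => [|[|[|a]]]; case: j => [|j] //=; apply: mem_ext => v;
    by rewrite !mem_cat => ->; rewrite ?orbT.
have [t [b [h _ hb _]]] := exec_den (@lattice_ok_le _) (lattice_ok0 _ _)
  (lattice_ok1 DL) (@lattice_okD _) (@lattice_okB _) (@lattice_ok_bits _ _ D0 DL)
  (@lattice_ok_bitsV _ _ D0 DL) wp (fun r => leq_trans (input_bounds I r) nmL) okI.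
exists t, b, (den p (input I)); split=> //; apply: leq_trans hb _.
apply: leq_trans (poly_bound_add _ _ _).
apply: leq_add; last exact: poly_bound_const.
apply: leq_trans (poly_bound_add _ _ _).
rewrite doubleD leq_add //.
  apply: leq_trans (_ : 4 * L.+1 ^ 1 <= _)%N; first by rewrite expn1; lia.
  by rewrite leq_mul // leq_pexp2l.
by apply: leq_trans (poly_bound_add _ _ _); rewrite -addnn leq_add.
Qed.

(** * The greedy algorithm for the linear relaxation *)

Section Greedy.
Variable F : realFieldType.
Implicit Types (p w c y : nat -> F) (lo hi : nat -> nat -> F).

(** Ties between processing times are broken by the index, which makes the order total and keeps it
    compatible with the deadlines. *)
Definition lex p (j l : nat) : bool :=
  (p j < p l) || ((p j <= p l) && (j < l)%N).

Definition lexle p (j l : nat) : bool := ~~ lex p l j.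

Lemma lexle_p p j l : lexle p j l -> p j <= p l.
Proof. by rewrite /lexle /lex negb_or -leNgt => /andP[]. Qed.

Lemma lexle_refl p j : lexle p j j.
Proof. by rewrite /lexle /lex ltxx ltnn andbF. Qed.

Lemma lexleE p j l : lexle p j l = (p j < p l) || ((p j == p l) && (j <= l)%N).
Proof.
rewrite /lexle /lex negb_or negb_and -leqNgt -leNgt -ltNge.
by case: (ltgtP (p j) (p l)).
Qed.

Lemma lexle_trans p : transitive (lexle p).
Proof.
move=> l j k; rewrite !lexleE.
case/orP=> [h1|/andP[/eqP e1 h1]]; case/orP=> [h2|/andP[/eqP e2 h2]].
- by rewrite (lt_trans h1 h2).
- by rewrite -e2 h1.
- by rewrite e1 h2.
- by rewrite e1 e2 eqxx (leq_trans h1 h2) orbT.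
Qed.

Lemma lexle_anti p j l : lexle p j l -> lexle p l j -> j = l.
Proof.
rewrite !lexleE; case: (ltgtP (p j) (p l)) => //= _ h1 h2.
by apply/eqP; rewrite eqn_leq h1.
Qed.

Lemma lexNle p j l : lex p j l = ~~ lexle p l j.
Proof. by rewrite negbK. Qed.

Lemma lex_lexle p j l : lex p j l -> lexle p j l.
Proof. 
rewrite lexleE => /orP[->//|/andP[h1 h2]].
by rewrite (ltnW h2) andbT orbC -le_eqVlt.
Qed.

Lemma lex_neq p j l : lex p j l = (j != l) && lexle p j l.
Proof.
apply/idP/andP => [h|[h1 h2]].
  split; last exact: lex_lexle.
  by apply: contraTneq h => ->; rewrite lexNle lexle_refl.
by rewrite lexNle; apply: contra h1 => h; rewrite (lexle_anti h h2).
Qed.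

Lemma lex_le_trans p j l k : lex p j l -> lexle p l k -> lex p j k.
Proof. by rewrite !lexNle => h1 h2; apply: contra h1; exact: lexle_trans. Qed.

Lemma le_lex_trans p j l k : lexle p j l -> lex p l k -> lex p j k.
Proof. by rewrite !lexNle => h1; apply: contra => h; exact: lexle_trans h1. Qed.

Lemma lex_max_exists p (A : pred nat) k : 
  (forall j, (j < k)%N -> ~~ A j) \/
  exists s, [/\ (s < k)%N, A s & forall j, (j < k)%N -> A j -> lexle p j s].
Proof.
elim: k => [|k [IH|[s [sk As IH]]]]; first by left.
  have [Ak|Ak] := boolP (A k); [right|left].
    exists k; split=> // j; rewrite ltnS leq_eqVlt => /predU1P[->|/IH/negbTE->//].
    by rewrite lexle_refl.
  by move=> j; rewrite ltnS leq_eqVlt => /predU1P[->//|/IH].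
right; have [/andP[Ak h]|h] := boolP (A k && lex p s k).
  exists k; split=> // j; rewrite ltnS leq_eqVlt => /predU1P[->|jk Aj].
    by rewrite lexle_refl.
  exact: lexle_trans (IH _ jk Aj) (lex_lexle h).
exists s; split=> //; first exact: ltnW.
move=> j; rewrite ltnS leq_eqVlt => /predU1P[->|/IH//] Ak.
by move: h; rewrite Ak.
Qed.

Fixpoint scan_max (P : pred nat) (f : nat -> F) (x0 : F) k : F :=
  if k is k'.+1 then
    let r := scan_max P f x0 k' in if P k' && (r < f k') then f k' else r
  else x0.

Lemma scan_max_ge_init (P : pred nat) f x0 k : x0 <= scan_max P f x0 k.
Proof.
elim: k => //= k IH; case: ifP => // /andP[_ /ltW]; exact: le_trans.
Qed.

Lemma scan_max_ge (P : pred nat) f x0 k j : (j < k)%N -> P j -> f j <= scan_max P f x0 k.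
Proof.
elim: k => //= k IH; rewrite ltnS leq_eqVlt => /predU1P[->|jk] Pj.
  by rewrite Pj /=; case: ltP.
by apply: le_trans (IH jk Pj) _; case: ifP => // /andP[_ /ltW].
Qed.

Lemma scan_maxP (P : pred nat) f x0 k :
  scan_max P f x0 k = x0 \/
  exists j, [/\ (j < k)%N, P j & scan_max P f x0 k = f j].
Proof.
elim: k => /= [|k IH]; first by left.
case: ifP => [/andP[Pk _]|_]; first by right; exists k.
by case: IH => [->|[j [jk Pj ->]]]; [left|right; exists j; rewrite (leqW jk)].
Qed.

Lemma scan_max_le (P : pred nat) f x0 k b : x0 <= b ->
  (forall j, (j < k)%N -> P j -> f j <= b) -> scan_max P f x0 k <= b.
Proof.
by move=> h0 h; case: (scan_maxP P f x0 k) => [->//|[j [jk Pj ->]]]; exact: h.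
Qed.

(** * The relaxed linear program and the greedy invariant *)

Variables (n m : nat) (p w c : nat -> F).
Hypothesis p_ge0 : forall j, 0 <= p j.

Notation lt := (lex p).
Notation le := (lexle p).

(* Times are scaled by 2m + 1: job j runs on each shared processor before
   (m + 1) p_j and for at most m p_j on all of them together. *)
Definition dl j : F := m.+1%:R * p j.
Definition quota j : F := m%:R * p j.
Definition load y l : F := \sum_(j < n | le j l) y j.

Lemma dl_ge0 j : 0 <= dl j. Proof. by rewrite mulr_ge0. Qed.
Lemma quota_ge0 j : 0 <= quota j. Proof. by rewrite mulr_ge0. Qed.
Lemma dl_le j l : le j l -> dl j <= dl l.
Proof. by move=> /lexle_p h; rewrite ler_wpM2l. Qed.

(** Here [x i j] is the amount of job j on processor i. Of the timing of the pieces, only the total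
    length due by each deadline is kept. *)
Record lp_feasible (x : nat -> nat -> F) : Prop := LpFeasible {
  lp_ge0 : forall i j, 0 <= x i j;
  lp_load : forall i l, (i < m)%N -> (l < n)%N -> load (x i) l <= dl l;
  lp_quota : forall j, (j < n)%N -> \sum_(i < m) x i j <= quota j
}.

Definition pos (r : F) := Num.max 0 r.

(** Only the part above theta of the interval from [c i] to [w j] counts; once theta is below all
    costs, this is the full positive part of the gain. *)
Definition lp_value (theta : F) (x : nat -> nat -> F) : F :=
  \sum_(i < m) \sum_(j < n) x i j * pos (w j - Num.max (c i) theta).

(** A unit on a separated processor earns its true gain; a unit in the pool pays the current
    threshold in place of a cost. *)
Definition value theta y (u : nat -> nat -> F) : F :=
  \sum_(i < m) \sum_(j < n) u i j * (w j - c i) +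
  \sum_(j < n) y j * (w j - theta).

(* A tight deadline after which all admitted jobs have their full quota shows that the
   pooled amounts are maximum. *)
Definition certificate k (J : pred nat) y : Prop :=
  (forall j, (j < n)%N -> J j -> y j = quota j) \/
  exists l, [/\ (l < n)%N, load y l = k%:R * dl l &
    forall j, (j < n)%N -> J j -> lt l j -> y j = quota j].

(* Processors i >= k are already separated from the pool: on them, job j runs during
   ]lo i j, hi i j[. The pool of the first k processors holds the amounts y. *)
Record greedy_inv theta k (J : pred nat) y (lo hi : nat -> nat -> F) : Prop :=
  GreedyInv {
  gi_ge0 : forall j, (j < n)%N -> 0 <= y j;
  gi_load : forall l, (l < n)%N -> load y l <= k%:R * dl l;
  gi_out : forall j, (j < n)%N -> ~~ J j ->
    y j = 0 /\ \sum_(i < m) (hi i j - lo i j) = 0;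
  gi_cert : certificate k J y;
  gi_quota : forall j, (j < n)%N -> y j + \sum_(i < m) (hi i j - lo i j) <= quota j;
  gi_range : forall i j, (i < m)%N -> (j < n)%N ->
    [/\ 0 <= lo i j, lo i j <= hi i j & hi i j <= dl j];
  gi_pool : forall i j, (i < k)%N -> lo i j = hi i j;
  gi_disj : forall i j l, (i < m)%N -> (j < n)%N -> (l < n)%N ->
    lt j l -> hi i j <= lo i l;
  gi_c_le : forall i, (i < k)%N -> c i <= theta;
  gi_c_ge : forall i, (k <= i < m)%N -> theta <= c i;
  gi_w : forall j, (j < n)%N -> ~~ J j -> w j <= theta;
  gi_value : forall x, lp_feasible x ->
    lp_value theta x <= value theta y (fun i j => hi i j - lo i j)
}.

(** The certificate acts as a minimum cut: jobs up to l are limited by the capacity of k processors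
    before the deadline of l, later ones by their quotas, and y attains both limits. *)
Lemma pool_max k J y x : (k <= m)%N -> lp_feasible x ->
  (forall j, (j < n)%N -> 0 <= y j) -> certificate k J y ->
  \sum_(i < m | (i < k)%N) \sum_(j < n | J j) x i j <= \sum_(j < n) y j.
Proof.
move=> km [x0 xl xq] y0 cert; rewrite exchange_big /=.
have full j : (j < n)%N -> J j -> \sum_(i < m | (i < k)%N) x i j <= quota j.
  move=> jn _; apply: le_trans (xq _ jn).
  rewrite [leRHS](bigID (fun i : 'I_m => (i < k)%N)) /= lerDl.
  exact: sumr_ge0.
case: cert => [cert|[l [ln tight cert]]].
  rewrite [leRHS](bigID (fun j : 'I_n => J j)) /= -[leLHS]addr0; apply: lerD.
    by apply: ler_sum => j Jj; rewrite cert // full.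
  by apply: sumr_ge0 => j _; exact: y0.
rewrite [leRHS](bigID (fun j : 'I_n => le j l)) /= [leLHS](bigID (fun j : 'I_n => le j l)) /=.
apply: lerD.
  rewrite -/(load y l) tight.
  apply: (@le_trans _ _ (\sum_(i < m | (i < k)%N) load (x i) l)).
    rewrite /load [leRHS]exchange_big /= [leLHS]big_mkcondl /=; apply: ler_sum => j _.
    by case: ifP => // _; exact: sumr_ge0.
  apply: (@le_trans _ _ (\sum_(i < m | (i < k)%N) dl l)).
    by apply: ler_sum => i _; exact: xl.
  by rewrite -(big_ord_widen m (fun=> dl l) km) sumr_const card_ord mulr_natl.
rewrite [leLHS]big_mkcondl /=; apply: ler_sum => j lj.
case: ifP => [Jj|_]; last exact: y0.
by rewrite cert ?full // lexNle.
Qed.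

Lemma greedy_lower theta theta' k J y lo hi : (k <= m)%N -> theta' <= theta ->
  (forall i, (i < k)%N -> c i <= theta') ->
  (forall j, (j < n)%N -> ~~ J j -> w j <= theta') ->
  greedy_inv theta k J y lo hi -> greedy_inv theta' k J y lo hi.
Proof.
move=> km tt ct wt [y0 yl yout cert yq range pool disj cle cge hw val].
split=> // [i ki|x hx]; first exact: le_trans tt (cge _ ki).
have mx : \sum_(i < m | (i < k)%N) \sum_(j < n | J j) x i j <= \sum_(j < n) y j.
  exact: pool_max.
have -> u : value theta' y u = value theta y u + (theta - theta') * \sum_(j < n) y j.
  rewrite /value -addrA mulr_sumr -big_split /=; congr (_ + _).
  by apply: eq_bigr => j _; ring.
apply: (@le_trans _ _ (lp_value theta x +
    (theta - theta') * \sum_(i < m | (i < k)%N) \sum_(j < n | J j) x i j)); last first.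
  by apply: lerD; [auto|rewrite ler_wpM2l // subr_ge0].
rewrite mulr_sumr [X in _ + X]big_mkcond /= -big_split /=; apply: ler_sum => i _.
have x0 j : 0 <= x i j by case: hx.
(* On a separated processor the cost is at least theta, so neither threshold has an effect. *)
case: ifP => ik; last first.
  rewrite addr0; apply: ler_sum => j _; rewrite ler_wpM2l //.
  have h : theta <= c i by apply: cge; rewrite leqNgt ik ltn_ord.
  by rewrite (max_l h) (max_l (le_trans tt h)).
rewrite mulr_sumr [X in _ + X]big_mkcond /= -big_split /=; apply: ler_sum => j _.
have h : c i <= theta' by exact: ct.
rewrite (max_r h) (max_r (le_trans h tt)).
case: ifPn => [Jj|Jj].
  rewrite [(theta - theta') * _]mulrC -mulrDr ler_wpM2l // /pos.
  rewrite ge_max; apply/andP; split.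
    by rewrite addr_ge0 ?le_max ?lexx // subr_ge0.
  by rewrite -lerBlDr le_max; apply/orP; right; lra.
have hj : w j <= theta' by exact: wt.
rewrite addr0 ler_wpM2l // /pos (_ : Num.max 0 _ = 0) ?le_max ?lexx //.
by rewrite max_l // subr_le0.
Qed.

Lemma greedy_init : exists theta,
  greedy_inv theta m pred0 (fun=> 0) (fun _ _ => 0) (fun _ _ => 0).
Proof.
(* This threshold is at least every weight and cost, so both values start at 0. *)
pose theta : F := \sum_(j < n) `|w j| + \sum_(i < m) `|c i|.
have wt j : (j < n)%N -> w j <= theta.
  move=> jn; apply: le_trans (ler_norm _) _.
  rewrite /theta (bigD1 (Ordinal jn)) //= -addrA lerDl addr_ge0 //; exact: sumr_ge0.
have ct i : (i < m)%N -> c i <= theta.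
  move=> im; apply: le_trans (ler_norm _) _.
  rewrite /theta (bigD1 (Ordinal im)) //= addrCA lerDl addr_ge0 //; exact: sumr_ge0.
have z : \sum_(i < m) ((0 : F) - 0) = 0 by rewrite big1 // => i _; rewrite subr0.
exists theta; split=> //.
- by move=> l _; rewrite /load big1 // mulr_ge0 ?dl_ge0.
- by left.
- by move=> j _; rewrite z addr0 quota_ge0.
- by move=> i j _ _; rewrite dl_ge0.
- by move=> i /andP[h1 h2]; rewrite leqNgt h2 in h1.
- by move=> j jn _; exact: wt.
- move=> x hx; rewrite /value big1 ?add0r => [|i _]; last first.
    by rewrite big1 // => j _; rewrite oppr0 mul0r.
  rewrite big1 => [|j _]; last by rewrite mul0r.
  rewrite /lp_value big1 // => i _; rewrite big1 // => j _.
  by rewrite (max_r (ct _ _)) // /pos max_l ?mulr0 // subr_le0 wt.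
Qed.

(** * Admitting one job *)

Lemma le_load y l : (forall j, (j < n)%N -> 0 <= y j) -> (l < n)%N -> y l <= load y l.
Proof.
move=> y0 ln; rewrite /load (bigD1 (Ordinal ln)) ?lexle_refl //= lerDl.
by apply: sumr_ge0 => j _; exact: y0.
Qed.

Lemma load_update y b v l : (b < n)%N -> y b = 0 ->
  load (fun j => if j == b then v else y j) l =
  load y l + (if le b l then v else 0).
Proof.
move=> bn yb; have -> : (if le b l then v else 0) =
    \sum_(j < n) if nat_of_ord j == b then (if le b l then v else 0) else 0.
  rewrite (bigD1 (Ordinal bn)) //= eqxx big1 ?addr0 // => j.
  by rewrite -val_eqE /= => /negbTE ->.
rewrite /load [LHS]big_mkcond [X in X + _]big_mkcond -big_split /=.
apply: eq_bigr => j _; case: eqP => [->|_]; last by rewrite addr0.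
by rewrite yb if_same add0r.
Qed.

(** The amount v is the least of the quota of b and the slacks at the deadlines from b on, a minimum
    written as the opposite of a maximum. At threshold [w b] a unit of b in the pool is worth 0, so
    the value does not change. *)
Lemma greedy_admit k J y lo hi b : (k <= m)%N -> (b < n)%N -> ~~ J b ->
  greedy_inv (w b) k J y lo hi ->
  let v := - scan_max (le b) (fun l => load y l - k%:R * dl l) (- quota b) n in
  greedy_inv (w b) k (fun j => (j == b) || J j)
    (fun j => if j == b then v else y j) lo hi.
Proof.
move=> km bn Jb [y0 yl yout cert yq range pool disj cle cge hw val] v.
have [yb ub] := yout _ bn Jb.
have v0 : 0 <= v.
  rewrite /v oppr_ge0 scan_max_le //; first by rewrite oppr_le0 quota_ge0.
  by move=> j jn _; rewrite subr_le0 yl.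
have vq : v <= quota b by rewrite /v lerNl scan_max_ge_init.
have vE l : (l < n)%N -> le b l -> load y l + v <= k%:R * dl l.
  move=> ln bl; have := scan_max_ge (fun l => load y l - k%:R * dl l) (- quota b) ln bl.
  by rewrite -[leRHS]opprK -/v; lra.
have sum0 (f : nat -> F) : f b = 0 ->
    \sum_(j < n) (if (j == b :> nat) then v else y j) * f j = \sum_(j < n) y j * f j.
  move=> fb; apply: eq_bigr => j _; case: eqP => // ->.
  by rewrite fb !mulr0.
split=> //.
- by move=> j jn; case: eqP => // _; exact: y0.
- move=> l ln; rewrite load_update //; case: ifP => bl; first exact: vE.
  by rewrite addr0 yl.
- by move=> j jn; rewrite negb_or => /andP[/negbTE -> Jj]; exact: yout.
(* If the quota limits v, the old certificate survives. If the deadline of l does, it becomes tight,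
   and the later of l and any old tight deadline serves. *)
- have [vmax|[l [ln bl vmax]]] :=
    scan_maxP (le b) (fun l => load y l - k%:R * dl l) (- quota b) n.
    have vE' : v = quota b by rewrite /v vmax opprK.
    case: cert => [cert|[l [ln tight cert]]]; [left|right].
      by move=> j jn; case: eqP => [-> //|_] /=; exact: cert.
    exists l; split=> //.
      rewrite load_update //; case: ifP => bl; last by rewrite addr0.
      by apply/eqP; rewrite eq_le vE // -tight lerDl v0.
    by move=> j jn; case: eqP => [-> //|_] /=; exact: cert.
  have vE' : load y l + v = k%:R * dl l by rewrite /v vmax; ring.
  case: cert => [cert|[l' [ln' tight cert]]].
    right; exists l; split=> //; first by rewrite load_update // bl.
    move=> j jn; case: eqP => [->|_] /=; last by move=> ? _; exact: cert.
    by rewrite lexNle bl.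
  have [ll'|l'l] := boolP (le l l').
    right; exists l'; split=> //.
      have bl' := lexle_trans bl ll'.
      rewrite load_update // bl'; apply/eqP; rewrite eq_le vE //= -tight lerDl.
      exact: v0.
    move=> j jn; case: eqP => [->|_] /=; last exact: cert.
    by rewrite lexNle (lexle_trans bl ll').
  right; exists l; split=> //; first by rewrite load_update // bl.
  move=> j jn; case: eqP => [->|_] /=; first by rewrite lexNle bl.
  move=> Jj lj; apply: cert => //; apply: le_lex_trans lj.
  by apply: lex_lexle; rewrite lexNle.
- move=> j jn; case: eqP => [->|_]; last exact: yq.
  by rewrite ub addr0.
- by move=> j jn; rewrite negb_or => /andP[_]; exact: hw.
- move=> x hx; apply: le_trans (val _ hx) _; rewrite /value lerD2l.
  by rewrite (sum0 (fun j => w j - w b)) // subrr.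
Qed.

(** * Separating one processor from the pool *)

Definition excess k y l : F := load y l - k%:R * dl l.
(** With [cut_hi], this is the running maximum of E, truncated at 0, before and after l. For E the
    excess of the pool, these are the least loads that the separated processor must have taken, and
    job l runs between them. *)
Definition cut_lo (E : nat -> F) l : F := scan_max (fun s => lt s l) E 0 n.
Definition cut_hi (E : nat -> F) l : F := Num.max (cut_lo E l) (E l).

Lemma cut_lo_ge0 E l : 0 <= cut_lo E l.
Proof. exact: scan_max_ge_init. Qed.

Lemma cut_lo_le_hi E l : cut_lo E l <= cut_hi E l.
Proof. by rewrite le_max lexx. Qed.

Lemma cut_disj E j l : (j < n)%N -> lt j l -> cut_hi E j <= cut_lo E l.
Proof.
move=> jn jl; rewrite ge_max scan_max_ge // andbT; apply: scan_max_le => [|s sn sj].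
  exact: cut_lo_ge0.
by apply: scan_max_ge => //; apply: lex_le_trans sj (lex_lexle jl).
Qed.

Lemma load_pred y l s : (l < n)%N -> (s < n)%N -> lt s l ->
  (forall j, (j < n)%N -> lt j l -> le j s) -> load y l = load y s + y l.
Proof.
move=> ln sn sl smax; rewrite /load (bigD1 (Ordinal ln)) ?lexle_refl //= addrC.
congr (_ + _); apply: eq_bigl => j; apply/andP/idP => [[jl jn]|js].
  by apply: smax => //; rewrite lex_neq jl andbT.
by have := le_lex_trans js sl; rewrite lex_neq => /andP[h ->].
Qed.

Lemma load_first y l : (l < n)%N -> (forall j, (j < n)%N -> ~~ lt j l) ->
  load y l = y l.
Proof.
move=> ln h; rewrite /load (bigD1 (Ordinal ln)) ?lexle_refl //= big1 ?addr0 // => j.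
by case/andP=> jl jn; have := h j (ltn_ord j); rewrite lex_neq jl andbT jn.
Qed.

Lemma cut_lo_first E l : (forall j, (j < n)%N -> ~~ lt j l) -> cut_lo E l = 0.
Proof.
move=> h; apply/eqP; rewrite eq_le cut_lo_ge0 andbT; apply: scan_max_le => // j jn.
by rewrite (negbTE (h j jn)).
Qed.

Lemma cut_lo_pred E l s : (s < n)%N -> lt s l ->
  (forall j, (j < n)%N -> lt j l -> le j s) -> cut_lo E l = cut_hi E s.
Proof.
move=> sn sl smax; apply/eqP; rewrite eq_le cut_disj // andbT.
apply: scan_max_le => [|j jn jl].
  by apply: le_trans (cut_lo_le_hi _ _); exact: cut_lo_ge0.
have [->|js] := eqVneq j s; first by rewrite le_max lexx orbT.
by rewrite le_max; apply/orP; left; apply: scan_max_ge => //; rewrite lex_neq js smax.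
Qed.

Lemma lex_ind (P : nat -> Prop) :
  (forall l, (l < n)%N -> (forall s, (s < n)%N -> lt s l -> P s) -> P l) ->
  forall l, (l < n)%N -> P l.
Proof.
move=> H l ln; pose mu l := #|[pred j : 'I_n | lt j l]|.
elim: {l}(mu l).+1 {-2}l (ltnSn (mu l)) ln => // d IH l ld ln.
apply: H => // s sn sl; apply: IH => //; rewrite -ltnS; apply: leq_trans ld.
rewrite ltnS; apply: proper_card; apply/properP; split.
  by apply/fintype.subsetP => j; rewrite !inE => js; exact: lex_le_trans js (lex_lexle sl).
by exists (Ordinal sn); rewrite !inE //= lex_neq eqxx.
Qed.

(* The cuts of consecutive jobs are adjacent, hence telescope. *)
Lemma load_cut E l : (l < n)%N -> load (fun j => cut_hi E j - cut_lo E j) l = cut_hi E l.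
Proof.
move: l; apply: lex_ind => l ln IH.
have [h|[s [sn sl smax]]] := lex_max_exists p (fun j => lt j l) n.
  by rewrite load_first // cut_lo_first // subr0.
rewrite (load_pred _ ln sn sl smax) IH // (cut_lo_pred E sn sl smax).
by rewrite addrCA subrr addr0.
Qed.

Lemma greedy_split k J y lo hi : (k < m)%N ->
  greedy_inv (c k) k.+1 J y lo hi ->
  let E := excess k y in
  greedy_inv (c k) k J (fun j => y j - (cut_hi E j - cut_lo E j))
    (fun i j => if i == k then cut_lo E j else lo i j)
    (fun i j => if i == k then cut_hi E j else hi i j).
Proof.
move=> km [y0 yl yout cert yq range pool disj cle cge hw val] E.
have El l : (l < n)%N -> E l <= dl l.
  by move=> /yl; rewrite /E /excess -natr1 mulrDl mul1r; lra.
have hi_le l : (l < n)%N -> cut_hi E l <= dl l.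
  move=> ln; rewrite ge_max El // andbT; apply: scan_max_le => [|s sn sl].
    exact: dl_ge0.
  by apply: le_trans (El _ sn) _; apply: dl_le; apply: lex_lexle.
(* From one deadline to the next the load rises by [y l] and the capacity does not fall, so the
   excess rises by at most [y l]. *)
have cut_le l : (l < n)%N -> cut_hi E l - cut_lo E l <= y l.
  move=> ln; rewrite lerBlDr ge_max lerDr y0 //=.
  have kdl s : 0 <= k%:R * dl s by rewrite mulr_ge0 ?dl_ge0.
  have [h|[s [sn sl smax]]] := lex_max_exists p (fun j => lt j l) n.
    rewrite {1}/E /excess (load_first _ ln h) lerD // -subr_ge0.
    by have := cut_lo_ge0 E l; have := kdl l; lra.
  rewrite {1}/E /excess (load_pred _ ln sn sl smax) (cut_lo_pred E sn sl smax).
  have h1 : E s <= cut_hi E s by rewrite le_max lexx orbT.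
  have h2 : k%:R * dl s <= k%:R * dl l.
    by rewrite ler_wpM2l //; apply: dl_le; apply: lex_lexle.
  by move: h1 h2; rewrite {1}/E /excess; lra.
have load' l : (l < n)%N ->
    load (fun j => y j - (cut_hi E j - cut_lo E j)) l = load y l - cut_hi E l.
  by move=> ln; rewrite -(load_cut E ln) /load sumrB.
have load'_le l : (l < n)%N ->
    load (fun j => y j - (cut_hi E j - cut_lo E j)) l <= k%:R * dl l.
  move=> ln; rewrite load' //.
  have : E l <= cut_hi E l by rewrite le_max lexx orbT.
  by rewrite {1}/E /excess; lra.
have usedE j : \sum_(i < m) ((if (i == k :> nat) then cut_hi E j else hi i j) -
      (if (i == k :> nat) then cut_lo E j else lo i j)) =
    \sum_(i < m) (hi i j - lo i j) + (cut_hi E j - cut_lo E j).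
  rewrite (bigD1 (Ordinal km)) //= eqxx addrC [in RHS](bigD1 (Ordinal km)) //=.
  rewrite (pool _ _ (ltnSn k)) subrr add0r; congr (_ + _); apply: eq_bigr => i.
  by rewrite -val_eqE /= => /negbTE ->.
split.
- by move=> j jn; rewrite subr_ge0 cut_le.
- exact: load'_le.
- move=> j jn Jj; have [yj uj] := yout j jn Jj.
  have h : cut_hi E j - cut_lo E j = 0.
    by apply/eqP; rewrite eq_le -{1}yj cut_le // subr_ge0 cut_lo_le_hi.
  by rewrite usedE uj h yj subr0 addr0.
(* If a positive amount of l moves, the running maximum is attained at l, and the move makes the
   deadline of l tight for k processors. *)
- have nontight l : (l < n)%N ->
      load (fun j => y j - (cut_hi E j - cut_lo E j)) l != k%:R * dl l ->
      y l - (cut_hi E l - cut_lo E l) = y l.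
    move=> ln; rewrite load' // /cut_hi; case: (leP (E l) (cut_lo E l)) => h.
      by rewrite subrr subr0.
    by rewrite {1}/E /excess opprB addrCA subrr addr0 eqxx.
  (* Processor k takes at most [dl l] by this deadline, so a deadline tight for k + 1 processors
     stays tight for k. *)
  have tight l : (l < n)%N -> load y l = k.+1%:R * dl l ->
      load (fun j => y j - (cut_hi E j - cut_lo E j)) l = k%:R * dl l.
    move=> ln t; apply/eqP; rewrite eq_le load'_le //= load' // t.
    by have := hi_le _ ln; rewrite -natr1 mulrDl mul1r; lra.
  (* The new certificate is the last tight deadline: later jobs are untouched, and an old tight
     deadline cannot lie after it. *)
  pose A l := load (fun j => y j - (cut_hi E j - cut_lo E j)) l == k%:R * dl l.
  have [none|[l0 [l0n /eqP t0 l0max]]] := lex_max_exists p A n.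
    case: cert => [cert|[l [ln t _]]].
      by left=> j jn Jj; rewrite nontight ?none // cert.
    by have := none l ln; rewrite /A tight ?eqxx.
  right; exists l0; split=> // j jn Jj l0j.
  have nt : ~~ A j by apply: contraL l0j => Aj; rewrite lexNle negbK l0max.
  rewrite nontight //; case: cert => [->//|[l [ln t ->//]]].
  by apply: le_lex_trans l0j; apply: l0max => //; rewrite /A tight.
- by move=> j jn; rewrite usedE; have := yq j jn; lra.
- move=> i j im jn; case: eqP => _; last exact: range.
  by rewrite cut_lo_ge0 cut_lo_le_hi hi_le.
- by move=> i j ik; rewrite ltn_eqF // pool // ltnS ltnW.
- move=> i j l im jn ln jl; case: eqP => _; [exact: cut_disj|exact: disj].
- by move=> i ik; apply: cle; rewrite ltnS ltnW.
- move=> i /andP[]; rewrite leq_eqVlt => /predU1P[<-//|ki im].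
  by apply: cge; rewrite ki.
- exact: hw.
(* The threshold equals [c k], so moving work from the pool to processor k preserves the value. *)
- move=> x hx; apply: le_trans (val x hx) _; rewrite le_eqVlt; apply/orP; left; apply/eqP.
  rewrite /value (bigD1 (Ordinal km)) //= [in RHS](bigD1 (Ordinal km)) //= eqxx.
  rewrite [X in X + _ + _]big1 => [|j _]; last first.
    by rewrite (pool _ _ (ltnSn k)) subrr mul0r.
  have -> : \sum_(j < n) (y j - (cut_hi E j - cut_lo E j)) * (w j - c k) =
     \sum_(j < n) y j * (w j - c k) -
     \sum_(j < n) (cut_hi E j - cut_lo E j) * (w j - c k).
    by rewrite -sumrB; apply: eq_bigr => j _; rewrite mulrBl.
  set A := \sum_(j < n) (cut_hi _ _ - _) * _.
  set B := \sum_(i < m | _) _; set B' := \sum_(i < m | _) _.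
  have -> : B' = B.
    by apply: eq_bigr => i; rewrite -val_eqE /= => /negbTE ->.
  by ring.
Qed.

(** A pool without processors is empty, and all costs are then at least theta, so [lp_value]
    truncates nothing. *)
Lemma greedy_final theta J y lo hi x : greedy_inv theta 0 J y lo hi -> lp_feasible x ->
  \sum_(i < m) \sum_(j < n) x i j * pos (w j - c i) <=
  \sum_(i < m) \sum_(j < n) (hi i j - lo i j) * (w j - c i).
Proof.
move=> [y0 yl yout cert yq range pool disj cle cge hw val] hx.
have := val x hx; rewrite /value [X in _ + X]big1 => [|j _]; last first.
  have -> : y j = 0; last by rewrite mul0r.
  apply/eqP; rewrite eq_le y0 // andbT; apply: le_trans (le_load y0 _) _ => //.
  by apply: le_trans (yl _ _) _ => //; rewrite mul0r.
rewrite addr0 => h; apply: le_trans h; rewrite le_eqVlt; apply/orP; left; apply/eqP.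
apply: eq_bigr => i _; apply: eq_bigr => j _.
by rewrite (max_l (cge i (ltn_ord i))).
Qed.

End Greedy.

(** * Schedules and the linear relaxation *)

Section DisjointIntervals.
Variable F : realFieldType.
Implicit Types (q r : F * F) (s : seq (F * F)).

Definition apart q r := (q.2 <= r.1) || (r.2 <= q.1).

(** The list need not be sorted: its first interval splits the others into those to its right and
    those to its left, each group confined to a smaller range, and the induction is on the
    length. *)
Lemma total_length_le (a b : F) s : a <= b ->
  (forall q, q \in s -> [/\ a <= q.1, q.1 < q.2 & q.2 <= b]) -> pairwise apart s ->
  \sum_(q <- s) (q.2 - q.1) <= b - a.
Proof.
elim: {s}(size s).+1 {-2}s (ltnSn (size s)) a b => // k IH [|q s] /= sk a b ab hs.
  by rewrite big_nil subr_ge0.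
case/andP=> /allP hq hp.
have [aq qq qb] := hs q (mem_head _ _).
rewrite big_cons (bigID (fun r => q.2 <= r.1)) /=
  -[X in _ + (X + _)]big_filter -[X in _ + (_ + X)]big_filter.
have sz P : (size (filter P s) < k)%N.
  by rewrite size_filter; apply: leq_ltn_trans (count_size _ _) _; rewrite -ltnS.
have hR : \sum_(r <- [seq r <- s | q.2 <= r.1]) (r.2 - r.1) <= b - q.2.
  apply: IH => //; last by rewrite pairwise_filter.
  move=> r; rewrite mem_filter => /andP[qr rs].
  by have [_ h1 h2] := hs r (mem_behead (s := q :: s) rs).
have hL : \sum_(r <- [seq r <- s | ~~ (q.2 <= r.1)]) (r.2 - r.1) <= q.1 - a.
  apply: IH => //; last by rewrite pairwise_filter.
  move=> r; rewrite mem_filter => /andP[qr rs].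
  have [h1 h2 _] := hs r (mem_behead (s := q :: s) rs); split=> //.
  by have := hq r rs; rewrite /apart (negbTE qr).
by move: hR hL; set A := \sum_(r <- _) _; set B := \sum_(r <- _) _; lra.
Qed.

Lemma pairwise_flatten (T : eqType) (f : T -> seq (F * F)) (js : seq T) :
  uniq js -> (forall j, j \in js -> pairwise apart (f j)) ->
  (forall j l q r, j != l -> q \in f j -> r \in f l -> apart q r) ->
  pairwise apart (flatten [seq f j | j <- js]).
Proof.
move=> + + hne; elim: js => //= j js IH /andP[jjs ujs] hp.
rewrite pairwise_cat hp ?mem_head //= IH //; last first.
  by move=> l ljs; apply: hp; rewrite inE ljs orbT.
rewrite andbT; apply/allrelP => q r qj /flattenP[_ /mapP[l ljs ->] rl].
by apply: hne qj rl; apply: contraNneq jjs => ->.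
Qed.

End DisjointIntervals.

Section PieceSets.
Local Open Scope classical_set_scope.
Variable R : realType.
Implicit Types q r : R * R.

Lemma piece_setE q x : piece_set q x = (q.1 < x < q.2) :> Prop.
Proof. by rewrite /piece_set /= in_itv. Qed.

Lemma piece_set_apart q r : q.1 < q.2 -> r.1 < r.2 ->
  piece_set q `&` piece_set r = set0 <-> apart q r.
Proof.
move=> hq hr; split=> [h|].
  rewrite /apart leNgt [r.2 <= _]leNgt -negb_and; apply/negP => /andP[h1 h2].
  have hm : Num.max q.1 r.1 < Num.min q.2 r.2.
    by rewrite gt_max !lt_min hq hr h1 h2.
  have [m1 m2] := midf_lt hm.
  suff : set0 ((Num.max q.1 r.1 + Num.min q.2 r.2) / 2%:R) by [].
  rewrite -h; move: m1 m2; rewrite gt_max lt_min => /andP[a1 a2] /andP[b1 b2].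
  by split; rewrite piece_setE ?a1 ?a2.
move=> h; rewrite -subset0 => x []; rewrite !piece_setE => /andP[a1 a2] /andP[b1 b2].
by case/orP: h => h; lra.
Qed.

Lemma piece_set_sub q (C : R) : q.1 < q.2 -> 
  (piece_set q `<=` `]0, C[) <-> 0 <= q.1 /\ q.2 <= C.
Proof.
move=> hq; split=> [h|[h1 h2] x]; last first.
  by rewrite piece_setE /= in_itv /= => /andP[a b]; apply/andP; split; lra.
have sub x : q.1 < x < q.2 -> 0 < x < C.
  by move=> hx; have := h x; rewrite piece_setE /= in_itv /=; apply.
split; rewrite leNgt; apply/negP => hlt.
  have hm : q.1 < Num.min 0 q.2 by rewrite lt_min hlt hq.
  have [m1 m2] := midf_lt hm; move: m2; rewrite lt_min => /andP[m0 m2].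
  by have := sub _ (introT andP (conj m1 m2)); move=> /andP[]; lra.
have hm : Num.max q.1 C < q.2 by rewrite gt_max hlt hq.
have [m1 m2] := midf_lt hm; move: m1; rewrite gt_max => /andP[m0 m1].
by have := sub _ (introT andP (conj m0 m2)); move=> /andP[]; lra.
Qed.

End PieceSets.

Lemma extE (F : realFieldType) k (f : 'I_k -> F) (i : 'I_k) : ext f i = f i.
Proof. by rewrite /ext valK. Qed.

Lemma ext_ge0 (F : realFieldType) k (f : 'I_k -> F) i :
  (forall j, 0 <= f j) -> 0 <= ext f i.
Proof. by move=> f0; have [->|[j ->]] := ext_cases f i. Qed.

Lemma ext_ptime_ge0 (F : realFieldType) n m (I : instance F n m) j :
  0 <= ext (ptime I) j.
Proof. by apply: ext_ge0; exact: ptime_ge0. Qed.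

Lemma ext_cost_le (F : realFieldType) n m (I : instance F n m) i k :
  (i <= k < m)%N -> ext (cost I) i <= ext (cost I) k.
Proof.
move=> /andP[ik km]; rewrite (extE _ (Ordinal km)) (extE _ (Ordinal (leq_ltn_trans ik km))).
exact: cost_le.
Qed.

(** * Schedules as solutions of the relaxation *)

Section Relaxation.
Variables (R : realType) (n m : nat) (I : instance R n m).

Notation p := (ext (ptime I)).
Notation w := (ext (weight I)).
Notation c := (ext (cost I)).

Definition shared_len (S : schedule R n m) j i : R :=
  \sum_(q <- pieces S j i) piece_len q.

(** As times are multiplied by 2m + 1, the factor m + 1 shrinks lengths by beta. *)
Definition scaled_len S (i j : nat) : R :=
  m.+1%:R * ext (fun i => ext (fun j => shared_len S j i) j) i.

Section Feasible.
Variables (S : schedule R n m) (fS : feasible I S).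

Lemma piece_bounds j i q : q \in pieces S j i ->
  [/\ 0 <= q.1, q.1 < q.2 & q.2 <= completion S j].
Proof.
case: fS => -[_ hlt _] _ _ hsub qj; have lt := hlt j i q qj.
by have /(piece_set_sub _ lt) [] := hsub j i q qj.
Qed.

Lemma pieces_apart j i : pairwise (@apart R) (pieces S j i).
Proof.
apply/(pairwiseP (0, 0)) => k l ks ls kl; rewrite !inE in ks ls.
case: fS => -[_ hlt hdis] _ _ _.
apply/piece_set_apart; [by apply: hlt; exact: mem_nth..|].
by apply: hdis; rewrite kl.
Qed.

Lemma shared_len_ge0 j i : 0 <= shared_len S j i.
Proof.
rewrite /shared_len big_seq; apply: sumr_ge0 => q /piece_bounds[_ h _].
by rewrite subr_ge0 ltW.
Qed.

Lemma completion_ge0 j : 0 <= completion S j.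
Proof. by case: fS => -[]. Qed.

Lemma completionE j : completion S j + \sum_(i < m) shared_len S j i = ptime I j.
Proof. by case: fS. Qed.

Lemma completion_le j : completion S j <= ptime I j.
Proof. by rewrite -completionE lerDl sumr_ge0 // => i _; exact: shared_len_ge0. Qed.

Lemma shared_len_le j i : shared_len S j i <= completion S j.
Proof.
rewrite -[leRHS]subr0; apply: total_length_le; first exact: completion_ge0.
  by move=> q; exact: piece_bounds.
exact: pieces_apart.
Qed.

(** The pieces of j end by C_j <= p_j <= t, so all these disjoint pieces lie between 0 and t. *)
Lemma feasible_prefix (P : pred 'I_n) i (t : R) : 0 <= t ->
  (forall j, P j -> ptime I j <= t) -> \sum_(j < n | P j) shared_len S j i <= t.
Proof.
move=> t0 hP; pose js := [seq j <- index_enum 'I_n | P j].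
have -> : \sum_(j < n | P j) shared_len S j i =
   \sum_(q <- flatten [seq pieces S j i | j <- js]) (q.2 - q.1).
  by rewrite big_flatten big_map big_filter.
rewrite -[leRHS]subr0; apply: total_length_le => //.
  move=> q /flattenP[_ /mapP[j + ->] qj]; rewrite mem_filter => /andP[Pj _].
  have [h1 h2 h3] := piece_bounds qj; split=> //.
  by apply: le_trans h3 _; apply: le_trans (completion_le _) _; exact: hP.
apply: pairwise_flatten; first by rewrite filter_uniq // index_enum_uniq.
  by move=> j _; exact: pieces_apart.
move=> j l q r jl qj rl; case: fS => _ _ hd _.
by apply/piece_set_apart; [case: (piece_bounds qj)|case: (piece_bounds rl)|exact: hd jl qj rl].
Qed.

Lemma scaled_lenE (i : 'I_m) (j : 'I_n) : scaled_len S i j = m.+1%:R * shared_len S j i.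
Proof. by rewrite /scaled_len !extE. Qed.

Lemma scaled_len_lp_feasible : lp_feasible n m p (scaled_len S).
Proof.
split=> [i j|i l im ln|j jn].
- rewrite mulr_ge0 // ext_ge0 // => i'; rewrite ext_ge0 // => j'; exact: shared_len_ge0.
- rewrite /load /dl (extE _ (Ordinal ln)).
  under eq_bigr => j _ do rewrite (scaled_lenE (Ordinal im)).
  rewrite -mulr_sumr ler_wpM2l //; apply: feasible_prefix; first exact: ptime_ge0.
  by move=> j /lexle_p; rewrite (extE _ (Ordinal ln)) extE.
- rewrite /quota (extE _ (Ordinal jn)).
  under eq_bigr => i _ do rewrite (scaled_lenE i (Ordinal jn)).
  rewrite -mulr_sumr; set j' := Ordinal jn; have E := completionE j'.
  (* Each shared processor runs j for at most C_j. With A the shared total, A <= m C_j and A + C_j =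
     p_j give (m + 1) A <= m p_j. *)
  have : \sum_(i < m) shared_len S j' i <= m%:R * completion S j'.
    apply: (@le_trans _ _ (\sum_(i < m) completion S j')).
      by apply: ler_sum => i _; exact: shared_len_le.
    by rewrite sumr_const card_ord mulr_natl.
  rewrite -E -natr1; set A := \sum_(i < m) _; set C := completion S j'; lra.
Qed.

Lemma overlap_bounds j i : 0 <= overlap S j i <= shared_len S j i.
Proof.
apply/andP; split; first by apply: sumr_ge0 => q _; rewrite le_max lexx.
rewrite /overlap /shared_len big_seq [leRHS]big_seq; apply: ler_sum => q.
move=> /piece_bounds[h1 h2 h3]; rewrite ge_max subr_ge0 ltW //=.
by rewrite (max_l h1) (min_l h3).
Qed.

(** A feasible schedule may run jobs at a loss, where w_j < c_i; the positive part discards these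
    losses. *)
Lemma total_overlap_le : total_overlap I S <=
  \sum_(i < m) \sum_(j < n) shared_len S j i * pos (weight I j - cost I i).
Proof.
apply: ler_sum => i _; apply: ler_sum => j _.
have /andP[h1 h2] := overlap_bounds j i.
apply: (@le_trans _ _ (overlap S j i * pos (weight I j - cost I i))).
  by rewrite ler_wpM2l // /pos le_max lexx orbT.
by rewrite ler_wpM2r // /pos le_max lexx.
Qed.

End Feasible.

(** * Schedules from cuts, and the ratio *)

Section FromCuts.
Variables (theta : R) (J : pred nat) (y : nat -> R) (lo hi : nat -> nat -> R).
Hypothesis inv : greedy_inv n m p w c theta 0 J y lo hi.
(** Division by 2m + 1 undoes the scaling. Since [dl] and [quota] add up to d times the processing
    time, the completion below is what the shared processors leave of it. *)
Let d : R := m.*2.+1%:R.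
Variable S : schedule R n m.
Hypothesis piecesE : forall (j : 'I_n) (i : 'I_m),
  pieces S j i = if lo i j < hi i j then [:: (lo i j / d, hi i j / d)] else [::].
Hypothesis completionS : forall j : 'I_n,
  completion S j = (dl m p j + quota m p j - \sum_(i < m) (hi i j - lo i j)) / d.

Let d_gt0 : 0 < d. Proof. by rewrite ltr0n. Qed.
Let dE : d = m.+1%:R + m%:R. Proof. by rewrite /d -natrD -addnn addSn. Qed.

Lemma cuts_shared_len j i : shared_len S j i = (hi i j - lo i j) / d.
Proof.
rewrite /shared_len piecesE; case: ifPn => [_|].
  by rewrite big_seq1 /piece_len -mulrBl.
rewrite -leNgt big_nil => h.
have [_ h' _] := gi_range inv (ltn_ord i) (ltn_ord j).
by rewrite (le_anti (introT andP (conj h h'))) subrr mul0r.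
Qed.

Lemma cuts_mem j i q : q \in pieces S j i ->
  q = (lo i j / d, hi i j / d) /\ lo i j < hi i j.
Proof. by rewrite piecesE; case: ifP => // h; rewrite inE => /eqP ->. Qed.

Lemma cuts_quota (j : 'I_n) : 0 <= quota m p j - \sum_(i < m) (hi i j - lo i j).
Proof.
rewrite subr_ge0; apply: le_trans (gi_quota inv (ltn_ord j)).
by rewrite lerDr (gi_ge0 inv).
Qed.

(** At most the quota of j is used on the shared processors, so its private run lasts at least until
    its deadline, by which all its cuts end. *)
Lemma cuts_le_completion (i : 'I_m) (j : 'I_n) : hi i j / d <= completion S j.
Proof.
rewrite completionS ler_wpM2r ?invr_ge0 ?(ltW d_gt0) //.
have [_ _ h] := gi_range inv (ltn_ord i) (ltn_ord j).
rewrite -addrA -[leLHS]addr0 lerD //; exact: cuts_quota.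
Qed.

Lemma cuts_feasible : feasible I S.
Proof.
have lo0 (i : 'I_m) (j : 'I_n) : 0 <= lo i j / d.
  have [h _ _] := gi_range inv (ltn_ord i) (ltn_ord j).
  by rewrite divr_ge0 // ltW.
split; first split.
- move=> j; rewrite completionS divr_ge0 ?(ltW d_gt0) // -addrA addr_ge0 ?cuts_quota //.
  exact: dl_ge0 (ext_ptime_ge0 I) j.
- by move=> j i q /cuts_mem[-> h] /=; rewrite ltr_pM2r ?invr_gt0.
- by move=> j i k l; rewrite piecesE; case: ifP => _ /=; lia.
- move=> j; rewrite -/(shared_len S j _).
  under eq_bigr => i _ do rewrite -/(shared_len S j i) cuts_shared_len.
  rewrite -mulr_suml completionS -mulrDl subrK /dl /quota -mulrDl -dE extE.
  by rewrite mulrAC divff ?mul1r // gt_eqF.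
- move=> i j j' q q' jj' /cuts_mem[-> h] /cuts_mem[-> h'].
  apply/piece_set_apart; rewrite /= ?ltr_pM2r ?invr_gt0 //.
  rewrite /apart /= !ler_pM2r ?invr_gt0 //.
  have [jl|lj] := boolP (lex p j j').
    by rewrite (gi_disj inv (ltn_ord i) (ltn_ord j) (ltn_ord j') jl).
  rewrite (gi_disj inv (ltn_ord i) (ltn_ord j') (ltn_ord j)) ?orbT //.
  by rewrite lex_neq eq_sym jj'.
- move=> j i q /cuts_mem[-> h]; apply/piece_set_sub.
    by rewrite /= ltr_pM2r ?invr_gt0.
  by split=> //=; exact: cuts_le_completion.
Qed.

Lemma cuts_total_overlap : d * total_overlap I S =
  \sum_(i < m) \sum_(j < n) (hi i j - lo i j) * (w j - c i).
Proof.
rewrite /total_overlap mulr_sumr; apply: eq_bigr => i _.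
rewrite mulr_sumr; apply: eq_bigr => j _; rewrite !extE mulrA; congr (_ * _).
have -> : overlap S j i = shared_len S j i.
  rewrite /overlap /shared_len; apply: eq_big_seq => q qj.
  have [h1 h2 h3] := piece_bounds cuts_feasible qj.
  by rewrite (max_l h1) (min_l h3) max_r // subr_ge0 ltW.
by rewrite cuts_shared_len mulrC mulfVK // gt_eqF.
Qed.

Lemma cuts_ratio Sopt : feasible I Sopt ->
  (1 / 2 + 1 / (4 * m.+1%:R)) * total_overlap I Sopt <= total_overlap I S.
Proof.
move=> fO; have x := scaled_len_lp_feasible fO.
have := greedy_final inv x; rewrite -cuts_total_overlap.
set L := \sum_(i < m) \sum_(j < n) shared_len Sopt j i * pos (weight I j - cost I i).
have -> : \sum_(i < m) \sum_(j < n) scaled_len Sopt i j * pos (w j - c i) =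
    m.+1%:R * L.
  rewrite mulr_sumr; apply: eq_bigr => i _; rewrite mulr_sumr.
  by apply: eq_bigr => j _; rewrite scaled_lenE !extE mulrA.
have hL : total_overlap I Sopt <= L by exact: total_overlap_le.
have L0 : 0 <= L.
  apply: sumr_ge0 => i _; apply: sumr_ge0 => j _; apply: mulr_ge0.
    exact: shared_len_ge0.
  by rewrite /pos le_max lexx.
(* The algorithm attains the factor beta, here m + 1 over d, against [L]. As [L] bounds the value of
   [Sopt] and is nonnegative, it remains to compare the factors. *)
move=> h; have h' : m.+1%:R / d * L <= total_overlap I S.
  by rewrite mulrAC ler_pdivrMr // [leRHS]mulrC.
apply: le_trans h'; set M : R := m.+1%:R.
have M1 : 1 <= M by rewrite ler1n.
have dM : d = 2 * M - 1 by rewrite dE -[M in RHS]natr1 /M -natr1; lra.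
have a0 : 0 <= 1 / 2 + 1 / (4 * M) by rewrite addr_ge0 // divr_ge0 // mulr_ge0 //; lra.
apply: (@le_trans _ _ ((1 / 2 + 1 / (4 * M)) * L)); first by rewrite ler_wpM2l.
rewrite ler_wpM2r // ler_pdivlMr // dM -subr_ge0.
(* This is the margin of beta over the required ratio, multiplied by d. *)
have -> : M - (1 / 2 + 1 / (4 * M)) * (2 * M - 1) = 1 / (4 * M).
  by field; rewrite gt_eqF //; lra.
by rewrite divr_ge0 // mulr_ge0 //; lra.
Qed.

End FromCuts.

End Relaxation.

(** * The program *)

(* Index registers: input and output in 0, 1, 2; counters 10-14; 17 holds the job
   selected for admission; 18[j,0] is 1 if job j is admitted; 19 is scratch.
   Data registers: input and output in 0-4; 5 holds 2m + 1; at j, the arrays 6-10 hold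
   the scaled deadline, the remaining private time, the capacity of the pool before the
   deadline, the pooled amount and the excess of the pool; 11-15 are scalars. *)
Notation rP := 6%N (only parsing).
Notation rRem := 7%N (only parsing).
Notation rCap := 8%N (only parsing).
Notation rY := 9%N (only parsing).
Notation rX := 10%N (only parsing).
Notation rAdm := 18%N (only parsing).

Notation ix a := (IGet a (ILit 0) (ILit 0)).
Notation dx a := (DGet a (ILit 0) (ILit 0)).
Notation da a i := (DGet a i (ILit 0)).
Notation seti0 a e := (PSetI a (ILit 0) (ILit 0) e).
Notation setd0 a e := (PSetD a (ILit 0) (ILit 0) e).
Notation seta a i e := (PSetD a i (ILit 0) e).

(** Disjunction is expressed by a negated conjunction, and a weak inequality by a negated strict
    one. *)
Definition lexb (i j : iexp) : bexp :=
  BNot (BAnd (BNot (BLtD (da 0 i) (da 0 j)))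
             (BNot (BAnd (BNot (BLtD (da 0 j) (da 0 i))) (BLtI i j)))).

(* Data register [a] takes the maximum of its value and of the entries of the array [arr]
   at the indices satisfying [b]; index register [r] takes the index of the maximum. *)
Definition scan_prog (ct r a arr : nat) (b : bexp) : prog :=
  PFor ct 0 (PWhen (BAnd b (BLtD (dx a) (da arr (ix ct))))
    (PSeq (seti0 r (ix ct)) (setd0 a (da arr (ix ct))))).

Definition sum_prog : prog :=
  PSeq (setd0 11 (DLit 0))
    (PFor 14 0 (PWhen (BNot (lexb (ix 13) (ix 14)))
      (setd0 11 (DAdd (dx 11) (da rY (ix 14)))))).

Definition excess_prog : prog :=
  PFor 13 0 (PSeq sum_prog (seta rX (ix 13) (DSub (dx 11) (da rCap (ix 13))))).

(** As counter 10 rises from 0, the processors are visited from the most expensive down. *)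
Definition processor : iexp := ISub (ISub (IGet 0 (ILit 1) (ILit 0)) (ILit 1)) (ix 10).

(** Starting the maximum at the cost of the processor selects only heavier jobs; the value n in
    register 17 means that there is none. *)
Definition select_prog : prog :=
  PSeq (setd0 12 (da 2 processor))
  (PSeq (seti0 17 (IGet 0 (ILit 0) (ILit 0)))
        (scan_prog 12 17 12 1 (BNot (BLtI (ILit 0) (IGet rAdm (ix 12) (ILit 0)))))).

(** The scan starts at p - (m + 1) p = - m p, the opposite of the quota. *)
Definition admit_selected_prog : prog :=
  PSeq excess_prog
  (PSeq (setd0 13 (DSub (da 0 (ix 17)) (da rP (ix 17))))
  (PSeq (scan_prog 13 19 13 rX (BNot (lexb (ix 13) (ix 17))))
  (PSeq (seta rY (ix 17) (DSub (DLit 0) (dx 13)))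
        (PSetI rAdm (ix 17) (ILit 0) (ILit 1))))).

Definition admission_prog : prog :=
  PSeq select_prog (PWhen (BLtI (ix 17) (IGet 0 (ILit 0) (ILit 0))) admit_selected_prog).

Definition emit_prog : prog :=
  PSeq (PSetI 2 (ix 1) (ILit 0) (ix 13))
  (PSeq (PSetI 2 (ix 1) (ILit 1) processor)
  (PSeq (PSetD 3 (ix 1) (ILit 0) (DDiv (dx 14) (dx 5)))
  (PSeq (PSetD 3 (ix 1) (ILit 1) (DDiv (dx 15) (dx 5)))
        (seti0 1 (IAdd (ix 1) (ILit 1)))))).

Definition cut_bounds_prog : prog :=
  PSeq (setd0 14 (DLit 0))
  (PSeq (scan_prog 14 19 14 rX (lexb (ix 14) (ix 13)))
  (PSeq (setd0 15 (dx 14))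
        (PWhen (BLtD (dx 14) (da rX (ix 13))) (setd0 15 (da rX (ix 13)))))).

Definition cut_prog : prog :=
  PSeq cut_bounds_prog
  (PSeq (PWhen (BLtD (dx 14) (dx 15)) emit_prog)
  (PSeq (seta rY (ix 13) (DSub (da rY (ix 13)) (DSub (dx 15) (dx 14))))
        (seta rRem (ix 13) (DSub (da rRem (ix 13)) (DSub (dx 15) (dx 14)))))).

Definition map_prog (a : nat) (e : dexp) : prog := PFor 13 0 (seta a (ix 13) e).

Definition shrink_prog : prog := map_prog rCap (DSub (da rCap (ix 13)) (da rP (ix 13))).

Definition split_prog : prog := PSeq shrink_prog (PSeq excess_prog (PFor 13 0 cut_prog)).

Definition round_prog : prog := PSeq (PFor 11 0 admission_prog) split_prog.

(** Multiples are built by repeated addition, as only sums and differences are known to stay in the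
    lattice. *)
Definition quota_prog : prog :=
  PSeq (setd0 5 (DLit 1))
  (PFor 10 1 (PSeq (setd0 5 (DAdd (dx 5) (DAdd (DLit 1) (DLit 1))))
    (map_prog rP (DAdd (da rP (ix 13)) (da 0 (ix 13)))))).

Definition deadline_prog : prog :=
  PSeq (map_prog rP (DAdd (da rP (ix 13)) (da 0 (ix 13))))
       (map_prog rRem (DAdd (da rP (ix 13)) (DSub (da rP (ix 13)) (da 0 (ix 13))))).

Definition capacity_prog : prog :=
  PFor 10 1 (map_prog rCap (DAdd (da rCap (ix 13)) (da rP (ix 13)))).

Definition completion_prog : prog := map_prog 4 (DDiv (da rRem (ix 13)) (dx 5)).

Definition main_prog : prog :=
  PSeq quota_prog (PSeq deadline_prog (PSeq capacity_prog (PSeq (PFor 10 1 round_prog) completion_prog))).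

Lemma wf_main_prog : wf main_prog. Proof. by []. Qed.


Arguments den : simpl never.

Lemma upd_eq (T : Type) r a i j (v : T) : upd r a i j v a i j = v.
Proof. by rewrite /upd !eqxx. Qed.

Lemma upd_neq (T : Type) r a i j (v : T) a' i' j' :
  a' != a -> upd r a i j v a' i' j' = r a' i' j'.
Proof. by rewrite /upd => /negbTE ->. Qed.

(** * Specifications of the parts of the program *)

Section Semantics.
Variable F : realFieldType.
Implicit Type s : store F.

Notation col s a := (fun j => dreg s a j 0%N).

Lemma den_seq p1 p2 s : den (PSeq p1 p2) s = den p2 (den p1 s).
Proof. by []. Qed.

Lemma den_seti a i j e s :
  den (PSetI a i j e) s = seti s a (ieval s i) (ieval s j) (ieval s e).
Proof. by []. Qed.

Lemma den_setd a i j e s :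
  den (PSetD a i j e) s = setd s a (ieval s i) (ieval s j) (deval s e).
Proof. by []. Qed.

Lemma den_when b p s : den (PWhen b p) s = if beval s b then den p s else s.
Proof. by []. Qed.

Definition denE := (den_seq, den_seti, den_setd, den_when).

Lemma beval_lexb s i j :
  beval s (lexb i j) = lex (col s 0) (ieval s i) (ieval s j).
Proof. by rewrite /= /lex negb_and !negbK -leNgt. Qed.

Lemma scan_max_eq (P Q : pred nat) (f g : nat -> F) x0 k :
  (forall j, (j < k)%N -> P j = Q j) -> (forall j, (j < k)%N -> f j = g j) ->
  scan_max P f x0 k = scan_max Q g x0 k.
Proof.
elim: k => //= k IH hP hf; rewrite IH ?hP ?hf // => j jk; [apply: hP|apply: hf];
  exact: leqW.
Qed.

(** The test must amount to a predicate of the counter in every store that differs from s only in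
    the registers of the scan. *)
Lemma scan_prog_spec (ct r a arr : nat) b (P : pred nat) s :
  [&& ct != 0, r != 0, r != ct & a != arr]%N ->
  (forall s', agree [:: ct; r] [:: a] s s' -> beval s' b = P (ireg s' ct 0 0)) ->
  let s' := den (scan_prog ct r a arr b) s in
  dreg s' a 0 0 = scan_max P (col s arr) (dreg s a 0 0) (ireg s 0 0 0) /\
  (ireg s' r 0 0 = ireg s r 0 0 /\ dreg s' a 0 0 = dreg s a 0 0 \/
   [/\ (ireg s' r 0 0 < ireg s 0 0 0)%N, P (ireg s' r 0 0),
       dreg s' a 0 0 = dreg s arr (ireg s' r 0 0) 0 & dreg s a 0 0 < dreg s' a 0 0]).
Proof.
case/and4P=> ct0 r0 rct aarr hb; rewrite /scan_prog.
pose Inv k s' :=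
  dreg s' a 0 0 = scan_max P (col s arr) (dreg s a 0 0) k /\
  (ireg s' r 0 0 = ireg s r 0 0 /\ dreg s' a 0 0 = dreg s a 0 0 \/
   [/\ (ireg s' r 0 0 < k)%N, P (ireg s' r 0 0),
       dreg s' a 0 0 = dreg s arr (ireg s' r 0 0) 0 & dreg s a 0 0 < dreg s' a 0 0]).
apply: (for_ind (Inv := Inv)).
  by split=> //; left; rewrite /= upd_neq.
move=> k s' kN ctk ag [IH1 IH2].
have {}ag : agree [:: ct; r] [:: a] s s' by apply: agree_sub ag.
have arrE j : dreg s' arr j 0 = dreg s arr j 0.
  by apply: ag.2; rewrite inE eq_sym.
rewrite /Inv denE /= (hb _ ag) ctk arrE IH1 denE.
case: ifP => [/andP[Pk lt]|_] /=.
  rewrite !upd_eq (upd_neq _ _ _ _ _ _ rct) upd_eq.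
  rewrite upd_neq 1?eq_sym // ctk arrE; split=> //; right; split=> //.
  exact: le_lt_trans (scan_max_ge_init _ _ _ _) lt.
rewrite (upd_neq _ _ _ _ _ _ rct); split=> //.
case: IH2 => [|[h1 h2 h3 h4]]; first by left.
by right; split=> //; exact: leqW.
Qed.

Lemma sum_prog_spec s :
  dreg (den sum_prog s) 11 0 0 =
  load (ireg s 0 0 0) (col s 0) (col s rY) (ireg s 13 0 0).
Proof.
rewrite /sum_prog den_seq /load; set s0 := den _ s.
pose Inv k s' := dreg s' 11 0 0 =
  \sum_(j < k | lexle (col s 0) j (ireg s 13 0 0)) dreg s rY j 0.
apply: (for_ind (Inv := Inv)); first by rewrite /Inv big_ord0.
move=> k s' kN ctk [ai ad] IH; rewrite /Inv in IH *.
rewrite big_mkcond big_ord_recr -big_mkcond -IH.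
have e13 : ireg s' 13 0 0 = ireg s 13 0 0 by rewrite ai.
have e0 j : dreg s' 0 j 0 = dreg s 0 j 0 by rewrite ad.
have eY j : dreg s' rY j 0 = dreg s rY j 0 by rewrite ad.
have bE : beval s' (BNot (lexb (ix 13) (ix 14))) = lexle (col s 0) k (ireg s 13 0 0).
  by rewrite -[LHS]/(~~ beval s' (lexb _ _)) beval_lexb /= ctk e13 /lexle /lex !e0.
rewrite !denE bE /= fun_if /= /upd /= ctk eY.
by case: ifP => _ //=; rewrite addr0.
Qed.

Lemma excess_prog_spec s l : (l < ireg s 0 0 0)%N ->
  dreg (den excess_prog s) rX l 0 =
  load (ireg s 0 0 0) (col s 0) (col s rY) l - dreg s rCap l 0.
Proof.
rewrite /excess_prog => lN.
pose Inv k s' := forall l, (l < k)%N -> dreg s' rX l 0 =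
  load (ireg s 0 0 0) (col s 0) (col s rY) l - dreg s rCap l 0.
apply: (for_ind (Inv := Inv)) lN => // k s' kN ctk [ai ad] IH {}l; rewrite ltnS => lk.
have eY : col s' rY = col s rY by apply: funext => j; rewrite ad.
have e0 : col s' 0 = col s 0 by apply: funext => j; rewrite ad.
have [fi fd] := frame sum_prog s'.
rewrite !denE /= /upd /= fi // ctk sum_prog_spec eY e0 ctk ai // (fd rCap) // (ad rCap) //.
have [->|ne] := eqVneq l k; first by [].
by rewrite /= (fd rX) // IH // ltn_neqAle ne.
Qed.

Notation admitted s := (fun j => (0 < ireg s rAdm j 0)%N).
Notation proc s := (ireg s 0 1 0 - 1 - ireg s 10 0 0)%N.

Lemma scan_prog_frame ct r a arr b s :
  agree [:: ct; r] [:: a] s (den (scan_prog ct r a arr b) s).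
Proof. exact: (frame (scan_prog ct r a arr b) s). Qed.

Lemma select_prog_spec s :
  let b := ireg (den select_prog s) 17 0 0 in
  (b = ireg s 0 0 0 /\ forall j, (j < ireg s 0 0 0)%N -> ~~ admitted s j ->
     dreg s 1 j 0 <= dreg s 2 (proc s) 0) \/
  [/\ (b < ireg s 0 0 0)%N, ~~ admitted s b, dreg s 2 (proc s) 0 < dreg s 1 b 0 &
     forall j, (j < ireg s 0 0 0)%N -> ~~ admitted s j -> dreg s 1 j 0 <= dreg s 1 b 0].
Proof.
rewrite /select_prog !den_seq; set s1 := den _ (den _ s).
set b := ireg _ 17 0 0.
have eN : ireg s1 0 0 0 = ireg s 0 0 0 by [].
have e17 : ireg s1 17 0 0 = ireg s 0 0 0 by [].
have e12 : dreg s1 12 0 0 = dreg s 2 (proc s) 0 by [].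
have eA j : ireg s1 rAdm j 0 = ireg s rAdm j 0 by [].
have ew j : dreg s1 1 j 0 = dreg s 1 j 0 by [].
have [||e h] := @scan_prog_spec 12 17 12 1 (BNot (BLtI (ILit 0) (IGet rAdm (ix 12) (ILit 0))))
   (fun j => ~~ admitted s j) s1; first by [].
  by move=> s' [ai _] /=; rewrite ai.
rewrite eN e17 e12 -/b in e h; case: h => [[h1 h2]|[h1 h2 h3 h4]]; [left|right].
  split=> // j jN aj; rewrite -h2 e.
  exact: (scan_max_ge (fun j => dreg s1 1 j 0) _ jN).
split=> // [|j jN aj]; first by rewrite -ew -h3.
rewrite -[leRHS]ew -h3 e; exact: (scan_max_ge (fun j => dreg s1 1 j 0) _ jN).
Qed.

Lemma admit_selected_prog_spec s : let b := ireg s 17 0 0 in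
  let v := - scan_max (lexle (col s 0) b)
     (fun l => load (ireg s 0 0 0) (col s 0) (col s rY) l - dreg s rCap l 0)
     (dreg s 0 b 0 - dreg s rP b 0) (ireg s 0 0 0) in
  let s' := den admit_selected_prog s in
  (forall j, dreg s' rY j 0 = if j == b then v else dreg s rY j 0) /\
  (forall j, admitted s' j = (j == b) || admitted s j).
Proof.
move=> b v; rewrite /admit_selected_prog !den_seq; set s1 := den excess_prog s.
set s2 := den _ s1; set s3 := den _ s2.
have [i1 d1] : agree (iwrites excess_prog) (dwrites excess_prog) s s1 := frame _ _.
have e2 : dreg s2 13 0 0 = dreg s 0 b 0 - dreg s rP b 0.
  by rewrite /s2 denE /= /upd /= i1 // !d1.
have [||e3 _] := @scan_prog_spec 13 19 13 rX (BNot (lexb (ix 13) (ix 17)))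
   (lexle (col s 0) b) s2; first by [].
  move=> s' [ai ad]; rewrite -[LHS]/(~~ beval s' (lexb _ _)) beval_lexb /= /lexle /lex.
  by rewrite !ad // (ai 17%N) // /s2 denE /= /upd /= !d1 // i1.
have [i3 d3] : agree [:: 13%N; 19] [:: 13%N] s2 s3 := scan_prog_frame _ _ _ _ _ _.
rewrite e2 in e3.
have i3' a i j : a \notin [:: 13%N; 14; 19] -> ireg s3 a i j = ireg s a i j.
  move=> h; rewrite i3; last by apply: contra h; rewrite !inE; case: eqP => //= _ ->; rewrite orbT.
  rewrite /s2 denE /= i1 //.
  by apply: contra h; rewrite !inE => /orP[] ->; rewrite ?orbT.
have vE : dreg s3 13 0 0 = - v.
  rewrite e3 /v opprK /s2 denE /= !i1 //; apply: scan_max_eq => // l lN.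
  by rewrite /upd /= excess_prog_spec.
have d3' j : dreg s3 rY j 0 = dreg s rY j 0 by rewrite d3 // /s2 denE /= /upd /= d1.
rewrite !denE; split=> j /=; rewrite /upd /= !i3' // -/b.
  by rewrite vE d3' opprK add0r andbT.
by rewrite andbT; case: ifP.
Qed.

(** This is the piece list of [output] at natural numbers, so that it can be followed through a
    run. *)
Definition pcs s (j i : nat) : seq (F * F) :=
  [seq (dreg s 3 k 0, dreg s 3 k 1) | k <- iota 0 (ireg s 1 0 0)
     & (ireg s 2 k 0 == j) && (ireg s 2 k 1 == i)].

Lemma pcs_agree iw dw s s' : agree iw dw s s' ->
  1%N \notin iw -> 2%N \notin iw -> 3%N \notin dw -> forall j i, pcs s' j i = pcs s j i.
Proof.
move=> [ai ad] h1 h2 h3 j i; rewrite /pcs ai //.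
under eq_map => k do rewrite !ad //; congr map.
by apply: eq_filter => k; rewrite !ai.
Qed.

Lemma emit_prog_spec s j i : pcs (den emit_prog s) j i =
  pcs s j i ++ (if (j == ireg s 13 0 0) && (i == proc s)
                then [:: (dreg s 14 0 0 / dreg s 5 0 0, dreg s 15 0 0 / dreg s 5 0 0)]
                else [::]).
Proof.
rewrite /pcs /emit_prog !denE /= /upd /=.
rewrite iotaD add0n filter_cat map_cat; congr (_ ++ _).
  (* The new piece is written at the old count, so the entries below it are not disturbed. *)
  have old k : k \in iota 0 (ireg s 1 0 0) -> (k == ireg s 1 0 0) = false.
    by rewrite mem_iota add0n => /andP[_ h]; rewrite ltn_eqF.
  rewrite (@eq_in_filter _ _ (fun k => (ireg s 2 k 0 == j) && (ireg s 2 k 1 == i))).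
    by apply/eq_in_map => k; rewrite mem_filter => /andP[_ /old ->].
  by move=> k /old ->.
by rewrite /= !eqxx /= [_ == j]eq_sym [_ == i]eq_sym; case: ifP => _ //=; rewrite !eqxx.
Qed.

Notation clo s := (cut_lo (ireg s 0 0 0) (col s 0) (col s rX)).
Notation chi s := (cut_hi (ireg s 0 0 0) (col s 0) (col s rX)).

Lemma cut_bounds_prog_spec s : let l := ireg s 13 0 0 in
  let s' := den cut_bounds_prog s in
  dreg s' 14 0 0 = clo s l /\ dreg s' 15 0 0 = chi s l.
Proof.
move=> l; rewrite /cut_bounds_prog !den_seq; set s1 := den _ s; set s2 := den _ s1.
have [||e _] := @scan_prog_spec 14 19 14 rX (lexb (ix 14) (ix 13))
   (fun k => lex (col s 0) k l) s1; first by [].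
  by move=> s' [ai ad]; rewrite beval_lexb /= /lex !ad // (ai 13).
have [i2 d2] : agree [:: 14%N; 19] [:: 14%N] s1 s2 := scan_prog_frame _ _ _ _ _ _.
have e2 : dreg s2 14 0 0 = clo s l by [].
have e13 : ireg s2 13 0 0 = l by rewrite i2.
have eX : dreg s2 rX l 0 = dreg s rX l 0 by rewrite d2.
rewrite !denE /= /upd /= e13 eX e2 /cut_hi /Num.max /Order.max.
by case: ifP => _ /=; rewrite ?e2.
Qed.

Lemma cut_prog_spec s : let l := ireg s 13 0 0 in let s' := den cut_prog s in
  [/\ forall j, dreg s' rY j 0 =
        if j == l then dreg s rY j 0 - (chi s l - clo s l) else dreg s rY j 0,
      forall j, dreg s' rRem j 0 =
        if j == l then dreg s rRem j 0 - (chi s l - clo s l) else dreg s rRem j 0 &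
      forall j i, pcs s' j i = pcs s j i ++
        (if [&& clo s l < chi s l, j == l & i == proc s]
         then [:: (clo s l / dreg s 5 0 0, chi s l / dreg s 5 0 0)] else [::])].
Proof.
move=> l; rewrite /cut_prog 3!den_seq; set s1 := den _ s; set s2 := den _ s1.
have [lo1 hi1] := cut_bounds_prog_spec s; rewrite -/l -/s1 in lo1 hi1.
have ag1 : agree (iwrites cut_bounds_prog) (dwrites cut_bounds_prog) s s1 := frame _ _.
have [i1 d1] := ag1.
have [i2 d2] : agree (iwrites emit_prog) (dwrites emit_prog) s1 s2.
  exact: (frame (PWhen (BLtD (dx 14) (dx 15)) emit_prog) s1).
have e13 : ireg s2 13 0 0 = l by rewrite i2 // i1.
split=> [j|j|j i].
- rewrite !denE /= /upd /= e13 !d2 //= lo1 hi1 !d1 //.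
  by case: eqP => [->|].
- rewrite !denE /= /upd /= e13 !d2 //= lo1 hi1 !d1 //.
  by case: eqP => [->|].
have -> : pcs (den (seta rRem (ix 13) (DSub (da rRem (ix 13)) (DSub (dx 15) (dx 14))))
    (den (seta rY (ix 13) (DSub (da rY (ix 13)) (DSub (dx 15) (dx 14)))) s2)) j i = pcs s2 j i.
  by [].
rewrite /s2 denE /= lo1 hi1; case: ifP => _ /=; last first.
  by rewrite cats0 (pcs_agree ag1).
rewrite emit_prog_spec (pcs_agree ag1) // lo1 hi1 d1 // !i1 //.
Qed.


(** The loop does not rewrite the excess array, so all cuts refer to the pool before the loop
    although the amounts change. *)
Lemma cut_loop_prog_spec s : let s' := den (PFor 13 0 cut_prog) s in
  [/\ forall j, (j < ireg s 0 0 0)%N ->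
        dreg s' rY j 0 = dreg s rY j 0 - (chi s j - clo s j),
      forall j, (j < ireg s 0 0 0)%N ->
        dreg s' rRem j 0 = dreg s rRem j 0 - (chi s j - clo s j) &
      forall j i, (j < ireg s 0 0 0)%N -> pcs s' j i = pcs s j i ++
        (if (clo s j < chi s j) && (i == proc s)
         then [:: (clo s j / dreg s 5 0 0, chi s j / dreg s 5 0 0)] else [::])].
Proof.
pose Inv k s' := [/\ forall j, dreg s' rY j 0 =
        if (j < k)%N then dreg s rY j 0 - (chi s j - clo s j) else dreg s rY j 0,
      forall j, dreg s' rRem j 0 =
        if (j < k)%N then dreg s rRem j 0 - (chi s j - clo s j) else dreg s rRem j 0 &
      forall j i, pcs s' j i = pcs s j i ++
        (if [&& (j < k)%N, clo s j < chi s j & i == proc s]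
         then [:: (clo s j / dreg s 5 0 0, chi s j / dreg s 5 0 0)] else [::])].
suff: Inv (ireg s 0 0 0) (den (PFor 13 0 cut_prog) s).
  move=> [h1 h2 h3]; split=> [j jN|j jN|j i jN]; first by rewrite h1 jN.
    by rewrite h2 jN.
  by rewrite h3 jN.
apply: for_ind; first by split=> // j i; rewrite cats0.
move=> k s' kN ctk [ai ad] [IH1 IH2 IH3].
have eX : col s' rX = col s rX by apply: funext => j; rewrite ad.
have e0 : col s' 0 = col s 0 by apply: funext => j; rewrite ad.
have [h1 h2 h3] := cut_prog_spec s'.
rewrite ctk eX e0 !ai // ad // in h1 h2 h3.
split=> [j|j|j i].
- rewrite -[LHS]/(dreg (den cut_prog s') rY j 0) h1 IH1 ltnS [(j <= k)%N]leq_eqVlt.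
  by have [->|_] := eqVneq j k; rewrite ?ltnn.
- rewrite -[LHS]/(dreg (den cut_prog s') rRem j 0) h2 IH2 ltnS [(j <= k)%N]leq_eqVlt.
  by have [->|_] := eqVneq j k; rewrite ?ltnn.
rewrite -[LHS]/(pcs (den cut_prog s') j i) h3 IH3 ltnS [(j <= k)%N]leq_eqVlt.
have [->|_] := eqVneq j k; first by rewrite ltnn cats0.
by rewrite /= andbF cats0.
Qed.

(** The expression may read [a] itself from the current index on, where nothing has been overwritten
    yet. *)
Lemma map_prog_spec a e (g : nat -> F) s :
  (forall s', agree [:: 13%N] [:: a] s s' ->
     (forall l, (ireg s' 13 0 0 <= l)%N -> dreg s' a l 0 = dreg s a l 0) ->
     deval s' e = g (ireg s' 13 0 0)) ->
  forall l, dreg (den (map_prog a e) s) a l 0 =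
            if (l < ireg s 0 0 0)%N then g l else dreg s a l 0.
Proof.
move=> he.
apply: (for_ind (Inv := fun k s' => forall l, dreg s' a l 0 =
  if (l < k)%N then g l else dreg s a l 0)) => // k s' kN ctk ag IH l.
have {}ag : agree [:: 13%N] [:: a] s s' by exact: ag.
have hk j : (ireg s' 13 0 0 <= j)%N -> dreg s' a j 0 = dreg s a j 0.
  by rewrite ctk IH leqNgt => /negbTE ->.
rewrite denE /= (he _ ag hk) ctk /upd eqxx andbT /= IH ltnS [(l <= k)%N]leq_eqVlt.
by have [->|_] := eqVneq l k.
Qed.

Lemma map_prog_frame a e s : agree [:: 13%N] [:: a] s (den (map_prog a e) s).
Proof. exact: (frame (map_prog a e) s). Qed.

End Semantics.

(** * Correctness of the whole program *)

Section Correctness.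
Variables (F : realFieldType) (n m : nat) (I : instance F n m).
Implicit Type s : store F.

Notation col s a := (fun j => dreg s a j 0%N).
Notation admitted s := (fun j => (0 < ireg s rAdm j 0)%N).
Notation proc s := (ireg s 0 1 0 - 1 - ireg s 10 0 0)%N.
Notation p := (ext (ptime I)).
Notation w := (ext (weight I)).
Notation c := (ext (cost I)).

Lemma greedy_inv_eq theta k J (y y' : nat -> F) lo hi :
  (forall j, (j < n)%N -> y j = y' j) ->
  greedy_inv n m p w c theta k J y lo hi -> greedy_inv n m p w c theta k J y' lo hi.
Proof.
move=> yy [y0 yl yout cert yq range pool disj cle cge hw val].
have le l : load n p y l = load n p y' l by apply: eq_bigr => j _; exact: yy.
split=> //.
- by move=> j jn; rewrite -yy // y0.
- by move=> l ln; rewrite -le yl.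
- by move=> j jn; rewrite -yy //; exact: yout.
- case: cert => [cert|[l [ln t cert]]]; [left|right].
    by move=> j jn Jj; rewrite -yy // cert.
  exists l; split=> //; first by rewrite -le.
  by move=> j jn Jj lj; rewrite -yy // cert.
- by move=> j jn; rewrite -yy // yq.
- move=> x hx; apply: le_trans (val x hx) _; rewrite /value lerD2l.
  by apply: ler_sum => j _; rewrite yy.
Qed.

Record base s : Prop := Base {
  base_n : ireg s 0 0 0 = n;
  base_m : ireg s 0 1 0 = m;
  base_p : col s 0 = p;
  base_w : col s 1 = w;
  base_c : col s 2 = c;
  base_d : dreg s 5 0 0 = m.*2.+1%:R;
  base_dl : forall j, (j < n)%N -> dreg s rP j 0 = dl m p j
}.

Lemma base_agree iw dw s s' : agree iw dw s s' -> 0%N \notin iw ->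
  all (fun a => a \notin dw) [:: 0%N; 1; 2; 5; rP] -> base s -> base s'.
Proof.
move=> [ai ad] h0 /= /and5P[h00 h1 h2 h5 /andP[h6 _]] [bn bm bp bw bc bd bdl].
split; rewrite ?ai ?ad //; last by move=> j jn; rewrite ad // bdl.
- by rewrite -bp; apply: funext => j; rewrite ad.
- by rewrite -bw; apply: funext => j; rewrite ad.
- by rewrite -bc; apply: funext => j; rewrite ad.
Qed.

Definition missing s : nat := #|[pred j : 'I_n | ~~ admitted s j]|.

Definition all_admitted k s : Prop :=
  forall j, (j < n)%N -> ~~ admitted s j -> w j <= c k.

(** The last alternative measures progress: a pass that starts with a candidate reduces the number
    of missing jobs, so n passes suffice. *)
Lemma admission_step k theta lo hi s : (k < m)%N -> base s -> proc s = k ->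
  (forall l, (l < n)%N -> dreg s rCap l 0 = k.+1%:R * dl m p l) ->
  greedy_inv n m p w c theta k.+1 (admitted s) (col s rY) lo hi ->
  let s' := den admission_prog s in
  (exists theta', greedy_inv n m p w c theta' k.+1 (admitted s') (col s' rY) lo hi) /\
  (all_admitted k s' \/ ~ all_admitted k s /\ (missing s' < missing s)%N).
Proof.
move=> km bs ps cap gi; rewrite /admission_prog den_seq; set s1 := den select_prog s.
have ag1 : agree (iwrites select_prog) (dwrites select_prog) s s1 := frame _ _.
have [i1 d1] := ag1.
have bs1 : base s1 by apply: base_agree ag1 _ _ bs.
have eA : admitted s1 = admitted s by apply: funext => j; rewrite i1.
have eY : col s1 rY = col s rY by apply: funext => j; rewrite d1.
have := select_prog_spec s; rewrite ps (base_n bs) -/s1; set b := ireg s1 17 0 0.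
move=> h; rewrite denE; have -> : beval s1 (BLtI (ix 17) (IGet 0 (ILit 0) (ILit 0))) = (b < n)%N.
  by rewrite /= (base_n bs1).
have wE j : dreg s 1 j 0 = w j by rewrite -(base_w bs).
have cE j : dreg s 2 j 0 = c j by rewrite -(base_c bs).
case: h => [[bn h]|[bn Jb cb h]].
  rewrite bn ltnn eA eY; split; first by exists theta.
  left=> j jn; rewrite (_ : (0 < _)%N = admitted s j) ?i1 // => Jj.
  by have := h j jn Jj; rewrite wE cE.
rewrite bn; have [hy hJ] := admit_selected_prog_spec s1.
rewrite -/b (base_n bs1) in hy.
rewrite wE cE in cb.
have hw j : (j < n)%N -> ~~ admitted s j -> w j <= w b.
  by move=> jn Jj; have := h j jn Jj; rewrite !wE.
have wb : w b <= theta by exact: (gi_w gi).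
have gi' : greedy_inv n m p w c (w b) k.+1 (admitted s) (col s rY) lo hi.
  apply: greedy_lower wb _ hw gi => //.
  move=> i ik; apply: le_trans (ltW cb); apply: ext_cost_le; lia.
set s' := den admit_selected_prog s1 in hy hJ *.
have eAj j : (0 < ireg s' rAdm j 0)%N = (j == b) || (0 < ireg s rAdm j 0)%N.
  by rewrite hJ -/b i1.
have eA' : admitted s' = (fun j => (j == b) || admitted s j) by apply: funext.
split; last first.
  right; split.
    by move=> /(_ b bn Jb); rewrite leNgt cb.
  apply: proper_card; apply/fintype.properP; split.
    by apply/fintype.subsetP => j; rewrite !inE eAj negb_or => /andP[].
  by exists (Ordinal bn); rewrite !inE //= eAj eqxx.
exists (w b); have := greedy_admit (ext_ptime_ge0 I) km bn Jb gi'.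
rewrite eA' (_ : col s' rY = fun j => if j == b then
  - scan_max (lexle p b) (fun l => load n p (col s rY) l - k.+1%:R * dl m p l)
      (- quota m p b) n else dreg s rY j 0) //.
apply: funext => j; rewrite hy; case: eqP => _; last by rewrite d1.
congr (- _).
have -> : dreg s1 0 b 0 - dreg s1 rP b 0 = - quota m p b.
  rewrite -[dreg s1 0 b 0]/(col s1 0 b) (base_p bs1) (base_dl bs1) //.
  by rewrite /dl /quota -natr1; ring.
rewrite (base_p bs1) eY; apply: scan_max_eq => // l ln.
by rewrite d1 // cap.
Qed.

Lemma admission_loop k theta lo hi s : (k < m)%N -> base s -> proc s = k ->
  (forall l, (l < n)%N -> dreg s rCap l 0 = k.+1%:R * dl m p l) ->
  greedy_inv n m p w c theta k.+1 (admitted s) (col s rY) lo hi ->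
  let s' := den (PFor 11 0 admission_prog) s in
  greedy_inv n m p w c (c k) k.+1 (admitted s') (col s' rY) lo hi.
Proof.
move=> km bs ps cap gi.
have [[theta' gi'] done] : let s' := den (PFor 11 0 admission_prog) s in
   (exists theta', greedy_inv n m p w c theta' k.+1 (admitted s') (col s' rY) lo hi) /\
   (all_admitted k s' \/ (missing s' + ireg s 0 0 0 <= n)%N).
  apply: (for_ind (Inv := fun e s' =>
   (exists theta', greedy_inv n m p w c theta' k.+1 (admitted s') (col s' rY) lo hi) /\
   (all_admitted k s' \/ (missing s' + e <= n)%N))).
    split; first by exists theta.
    right; rewrite addn0; apply: leq_trans (max_card _) _; by rewrite card_ord.
  move=> e s' _ cte ag [[theta' gi'] IH].
  have bs' : base s' by apply: base_agree ag _ _ bs.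
  have ps' : proc s' = k by rewrite -ps !ag.1.
  have cap' l : (l < n)%N -> dreg s' rCap l 0 = k.+1%:R * dl m p l.
    by move=> ln; rewrite ag.2 // cap.
  have [[theta'' gi''] done] := admission_step km bs' ps' cap' gi'.
  split; first by exists theta''.
  case: done => [|[nd lt]]; first by left.
  (* The pass found a candidate, which excludes that none was left before it. *)
  case: IH => // IH; right; rewrite addnS; apply: leq_trans IH.
  by rewrite ltn_add2r.
set s' := den _ s in gi' done *.
have {}done : all_admitted k s'.
  case: done => // h j jn Jj.
  have /card0_eq/(_ (Ordinal jn)) : missing s' = 0%N
    by move: h; rewrite (base_n bs); lia.
  by rewrite !inE Jj.
(* With no candidate left, theta may fall to the cost of processor k, where the separation takes
   place. *)
apply: (greedy_lower _ _ _ done gi') => //; first exact: (gi_c_le gi').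
by move=> i ik; apply: ext_cost_le; lia.
Qed.

(** The cuts exist in the proof only; the machine keeps the pieces and the remaining private times
    that result from them. *)
Record round_inv k s : Prop := RoundInv {
  ri_base : base s;
  ri_cap : forall l, (l < n)%N -> dreg s rCap l 0 = k%:R * dl m p l;
  ri_greedy : exists theta lo hi,
    [/\ greedy_inv n m p w c theta k (admitted s) (col s rY) lo hi,
        forall j, (j < n)%N -> dreg s rRem j 0 =
          dl m p j + quota m p j - \sum_(i < m) (hi i j - lo i j) &
        forall j i, (j < n)%N -> (i < m)%N -> pcs s j i =
          if lo i j < hi i j then [:: (lo i j / m.*2.+1%:R, hi i j / m.*2.+1%:R)]
          else [::]]
}.

Lemma round_prog_spec k s : (k < m)%N -> proc s = k ->
  round_inv k.+1 s -> round_inv k (den round_prog s).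
Proof.
move=> km ps [bs cap [theta [lo [hi [gi rem pc]]]]].
rewrite /round_prog /split_prog 3!den_seq; set s1 := den (PFor 11 0 admission_prog) s.
have gi1 := admission_loop km bs ps cap gi; rewrite -/s1 in gi1.
have ag1 : agree (iwrites (PFor 11 0 admission_prog)) (dwrites (PFor 11 0 admission_prog)) s s1.
  exact: frame.
have bs1 : base s1 by apply: base_agree ag1 _ _ bs.
set s2 := den shrink_prog s1.
have ag2 : agree [:: 13%N] [:: rCap] s1 s2 by exact: map_prog_frame.
have bs2 : base s2 by apply: base_agree ag2 _ _ bs1.
have cap2 l : (l < n)%N -> dreg s2 rCap l 0 = k%:R * dl m p l.
  move=> ln; rewrite /s2 /shrink_prog (@map_prog_spec _ _ _
      (fun l => dreg s1 rCap l 0 - dreg s1 rP l 0)) //.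
    rewrite (base_n bs1) ln ag1.2 // cap // (base_dl bs1) // -natr1.
    by rewrite mulrDl mul1r addrK.
  by move=> s' ag h /=; rewrite h // ag.2.
set s3 := den excess_prog s2.
have ag3 : agree (iwrites excess_prog) (dwrites excess_prog) s2 s3 := frame _ _.
have bs3 : base s3 by apply: base_agree ag3 _ _ bs2.
have eY3 : col s3 rY = col s1 rY by apply: funext => j; rewrite ag3.2 // ag2.2.
have eX l : (l < n)%N -> dreg s3 rX l 0 = excess n m p k (col s1 rY) l.
  move=> ln; rewrite /s3 excess_prog_spec (base_n bs2) // (base_p bs2) cap2 //.
  by rewrite /excess -eY3; congr (load _ _ _ _ - _); apply: funext => j; rewrite ag3.2.
set s4 := den (PFor 13 0 cut_prog) s3.
have ag4 : agree (iwrites (PFor 13 0 cut_prog)) (dwrites (PFor 13 0 cut_prog)) s3 s4.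
  exact: frame.
have bs4 : base s4 by apply: base_agree ag4 _ _ bs3.
have gi4 := greedy_split (ext_ptime_ge0 I) km gi1.
set E := excess _ _ _ _ _ in gi4.
have [] := cut_loop_prog_spec s3; rewrite -/s4 (base_n bs3) (base_p bs3) (base_d bs3).
have loE j : cut_lo n p (col s3 rX) j = cut_lo n p E j.
  by rewrite /cut_lo; apply: scan_max_eq.
have hiE j : (j < n)%N -> cut_hi n p (col s3 rX) j = cut_hi n p E j.
  by move=> jn; rewrite /cut_hi loE eX.
have ps3 : proc s3 = k by rewrite !ag3.1 // !ag2.1 // !ag1.1.
rewrite ps3 => hy hrem hpc; split=> //.
  by move=> l ln; rewrite ag4.2 // ag3.2 // cap2.
have eA4 : admitted s4 = admitted s1.
  by apply: funext => j; rewrite ag4.1 // ag3.1 // ag2.1.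
exists (c k); do 2 eexists; split.
- rewrite eA4; apply: greedy_inv_eq gi4 => j jn.
  by rewrite hy // loE hiE // -[dreg s3 rY j 0]/(col s3 rY j) eY3.
- move=> j jn; rewrite hrem // loE hiE // ag3.2 // ag2.2 // ag1.2 // rem //.
  (* Processor k was in the pool before the round, so its old term is 0 and its new term is the
     cut. *)
  rewrite [in RHS](bigD1 (Ordinal km)) //= eqxx [in LHS](bigD1 (Ordinal km)) //=.
  rewrite (gi_pool gi _ (ltnSn k)) subrr add0r.
  set A := \sum_(i < m | _) _; set B := \sum_(i < m | _) _.
  have -> : B = A.
    by apply: eq_bigr => i; rewrite -val_eqE /= => /negbTE ->.
  by ring.
move=> j i jn im; rewrite hpc // (pcs_agree ag3) // (pcs_agree ag2) // (pcs_agree ag1) //.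
rewrite pc // loE hiE //; case: eqP => [->|_]; last by rewrite andbF cats0.
by rewrite (gi_pool gi _ (ltnSn k)) ltxx andbT.
Qed.

Lemma quota_prog_spec s : ireg s 0 0 0 = n -> ireg s 0 1 0 = m ->
  col s 0 = p -> (forall j, dreg s rP j 0 = 0) ->
  let s' := den quota_prog s in
  dreg s' 5 0 0 = m.*2.+1%:R /\
  forall j, (j < n)%N -> dreg s' rP j 0 = quota m p j.
Proof.
move=> en em ep P0; rewrite /quota_prog den_seq; set s1 := den _ s.
have em1 : ireg s1 0 1 0 = m by exact: em.
pose Inv k s' := dreg s' 5 0 0 = k.*2.+1%:R /\
  forall j, (j < n)%N -> dreg s' rP j 0 = quota k p j.
suff : Inv (ireg s1 0 1 0) (den (PFor 10 1 (PSeq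
    (setd0 5 (DAdd (dx 5) (DAdd (DLit 1) (DLit 1))))
    (map_prog rP (DAdd (da rP (ix 13)) (da 0 (ix 13)))))) s1) by rewrite em1.
apply: for_ind.
  by split=> // j jn; rewrite /quota mul0r; exact: P0.
move=> k s' _ ctk ag [IH1 IH2]; rewrite den_seq.
set s2 := den _ s'; set s3 := den _ s2.
have ag3 : agree [:: 13%N] [:: rP] s2 s3 by exact: map_prog_frame.
have p2 j : dreg s2 0 j 0 = p j.
  by rewrite -[LHS]/(dreg s' 0 j 0) ag.2 // -ep.
split.
  rewrite -[LHS]/(dreg s3 5 0 0) ag3.2 // /s2 denE /= /upd /= IH1.
  by rewrite -!natrD; congr (_%:R); lia.
move=> j jn; rewrite -[LHS]/(dreg s3 rP j 0) /s3.
rewrite (@map_prog_spec _ _ _ (fun j => dreg s2 rP j 0 + p j)) //.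
  have -> : ireg s2 0 0 0 = n by rewrite -[LHS]/(ireg s' 0 0 0) ag.1.
  rewrite jn -[dreg s2 rP j 0]/(dreg s' rP j 0) IH2 // /quota -natr1.
  by rewrite mulrDl mul1r.
by move=> t agt h /=; rewrite h // agt.2 // p2.
Qed.

Lemma main_prog_init : let s := den capacity_prog (den deadline_prog (den quota_prog (input I))) in
  round_inv m s.
Proof.
set s1 := den quota_prog _; set s2 := den deadline_prog _ => s.
have ag1 : agree (iwrites quota_prog) (dwrites quota_prog) (input I) s1 := frame _ _.
have ag2 : agree (iwrites deadline_prog) (dwrites deadline_prog) s1 s2 := frame _ _.
have ag3 : agree (iwrites capacity_prog) (dwrites capacity_prog) s2 s := frame _ _.
have [d1 P1] := quota_prog_spec (s := input I) erefl erefl erefl (fun=> erefl).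
rewrite -/s1 in d1 P1.
have p1 j : dreg s1 0 j 0 = p j by rewrite ag1.2.
pose s15 := den (map_prog rP (DAdd (da rP (ix 13)) (da 0 (ix 13)))) s1.
have ag15 : agree [:: 13%N] [:: rP] s1 s15 by exact: map_prog_frame.
have n1 : ireg s1 0 0 0 = n by rewrite ag1.1.
have P15 j : (j < n)%N -> dreg s15 rP j 0 = dl m p j.
  move=> jn; rewrite (@map_prog_spec _ _ _ (fun j => dreg s1 rP j 0 + p j)) //.
    by rewrite n1 jn P1 // /quota /dl -natr1 mulrDl mul1r.
  by move=> t agt h /=; rewrite h // agt.2 // p1.
have s2E : s2 = den (map_prog rRem (DAdd (da rP (ix 13))
    (DSub (da rP (ix 13)) (da 0 (ix 13))))) s15 by [].
have ag25 : agree [:: 13%N] [:: rRem] s15 s2 by rewrite s2E; exact: map_prog_frame.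
have rem2 j : (j < n)%N -> dreg s2 rRem j 0 = dl m p j + quota m p j.
  move=> jn; rewrite s2E (@map_prog_spec _ _ _ 
    (fun j => dreg s15 rP j 0 + (dreg s15 rP j 0 - dreg s15 0 j 0))) //.
    rewrite ag15.1 // n1 jn P15 // ag15.2 // p1 /dl /quota -natr1; ring.
  by move=> t agt h /=; rewrite !agt.2.
have bs2 : base s2.
  split; first by rewrite ag2.1.
  - by rewrite ag2.1 // ag1.1.
  - by apply: funext => j; rewrite ag2.2.
  - by apply: funext => j; rewrite ag2.2 // ag1.2.
  - by apply: funext => j; rewrite ag2.2 // ag1.2.
  - by rewrite ag2.2.
  - by move=> j jn; rewrite ag25.2 // P15.
split; first by apply: base_agree ag3 _ _ bs2.
  pose Inv k s' := forall l, (l < n)%N -> dreg s' rCap l 0 = k%:R * dl m p l.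
  suff : Inv (ireg s2 0 1 0) s by rewrite (base_m bs2).
  apply: for_ind.
    by move=> l ln; rewrite mul0r -[LHS]/(dreg s2 rCap l 0) ag2.2 // ag1.2.
  move=> k s' _ ctk ag IH l ln.
  rewrite -[LHS]/(dreg (den (map_prog rCap (DAdd (da rCap (ix 13)) (da rP (ix 13)))) s') rCap l 0).
  rewrite (@map_prog_spec _ _ _ (fun l => dreg s' rCap l 0 + dreg s' rP l 0)) //.
    rewrite ag.1 // (base_n bs2) ln IH // ag.2 // (base_dl bs2) // -natr1.
    by rewrite mulrDl mul1r.
  by move=> t agt h /=; rewrite h // agt.2.
have [theta gi] := greedy_init n m w c (ext_ptime_ge0 I).
exists theta, (fun _ _ => 0), (fun _ _ => 0); split.
- have -> : admitted s = pred0.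
    by apply: funext => j; rewrite ag3.1 // ag2.1 // ag1.1.
  by have -> : col s rY = fun=> 0
    by apply: funext => j; rewrite ag3.2 // ag2.2 // ag1.2.
- move=> j jn; rewrite ag3.2 // rem2 // big1 ?subr0 // => i _; exact: subrr.
- move=> j i _ _; rewrite ltxx (pcs_agree ag3) // (pcs_agree ag2) // (pcs_agree ag1) //.
Qed.

Lemma main_prog_spec : exists theta J y lo hi,
  [/\ greedy_inv n m p w c theta 0 J y lo hi,
      forall (j : 'I_n) (i : 'I_m), pieces (output n m (den main_prog (input I))) j i =
        if lo i j < hi i j then [:: (lo i j / m.*2.+1%:R, hi i j / m.*2.+1%:R)] else [::] &
      forall j : 'I_n, completion (output n m (den main_prog (input I))) j =
        (dl m p j + quota m p j - \sum_(i < m) (hi i j - lo i j)) / m.*2.+1%:R].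
Proof.
rewrite /main_prog 4!den_seq; have := main_prog_init; set s := den capacity_prog _ => /= hs.
set s1 := den (PFor 10 1 round_prog) s; set s2 := den completion_prog s1.
have [bs1 _ [theta [lo [hi [gi rem pc]]]]] : round_inv 0 s1.
  have -> : 0%N = (m - ireg s 0 1 0)%N by rewrite (base_m (ri_base hs)) subnn.
  (* After k rounds the pool has m - k processors left. *)
  apply: (for_ind (Inv := fun k s' => round_inv (m - k) s')).
    by rewrite subn0; case: hs => bs cap gs; split=> //; case: bs.
  rewrite (base_m (ri_base hs)) => k s' km ctk ag IH.
  have kk : (m - k = (m - k.+1).+1)%N by lia.
  rewrite kk in IH; have hproc : proc s' = (m - k.+1)%N.
    by rewrite ctk (base_m (ri_base IH)); lia.
  have := round_prog_spec _ hproc IH; move=> /(_ _)[|bs cap gs]; first by lia.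
  by split=> //; case: bs.
have ag2 : agree [:: 13%N] [:: 4%N] s1 s2 by exact: map_prog_frame.
exists theta, (admitted s1), (col s1 rY), lo, hi; split=> // [j i|j].
  by rewrite -[LHS]/(pcs s2 j i) (pcs_agree ag2) // pc.
rewrite -[LHS]/(dreg s2 4 j 0) /s2 /completion_prog.
rewrite (@map_prog_spec _ _ _ (fun j => dreg s1 rRem j 0 / dreg s1 5 0 0)) //.
  by rewrite (base_n bs1) ltn_ord rem // (base_d bs1).
by move=> t agt h /=; rewrite !agt.2.
Qed.

End Correctness.

Theorem theorem3 :
  exists prog : cmd,
    strongly_polynomial prog /\
    approximation_algorithm
      (fun (R : realType) (m : nat) => 1 / 2 + 1 / (4 * (m.+1)%:R) : R) prog.
Proof.
exists (compile main_prog); split; first exact: wf_strongly_polynomial wf_main_prog.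
move=> R n m I; exists (output n m (den main_prog (input I))).
have [theta [J [y [lo [hi [gi hp hc]]]]]] := main_prog_spec I.
split.
- have [t [b [h _]]] := exec_input I wf_main_prog.
  by exists t, b, (den main_prog (input I)).
- exact: (cuts_feasible gi hp hc).
- by move=> Sopt [fO _]; exact: (cuts_ratio gi hp hc fO).
Qed.
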